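(* Let $Y$ be a finite CW complex with $\dim Y>3$. Then there is a self-adjoint element $b\in C(Y, M_2)$ with $sp(b)=[-1,1]$ which cannot be approximately diagonalized.
   Context: $M_2$ is the algebra of $2\times 2$ complex matrices and $sp(b)$ is the spectrum of $b$ in $C(Y,M_2)$. A self-adjoint element $b\in C(Y,M_2)$ can be approximately diagonalized if for every $\epsilon>0$ there are continuous functions $\alpha_1,\alpha_2:Y\to\mathbb R$ and mutually orthogonal rank one projections $p_1,p_2\in C(Y,M_2)$ (i.e. $p_i(y)$ has rank one for every $y\in Y$) such that $\|b-(\alpha_1p_1+\alpha_2p_2)\|<\epsilon$. *)

(* Defs.v *)
From HB Require Import structures.
From mathcomp Require Export all_boot all_order all_algebra.
From mathcomp Require Export complex.
From mathcomp Require Export all_classical all_reals all_analysis.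
Export Order.TTheory GRing.Theory Num.Theory.
Export numFieldNormedType.Exports.

Set Implicit Arguments.
Unset Strict Implicit.
Unset Printing Implicit Defensive.

#[export] Set Warnings "-notation-overridden,-ambiguous-paths".

Global Open Scope classical_set_scope.
Global Open Scope complex_scope.
Global Open Scope ring_scope.

(* The library topologizes abstract numeric fields and K^o; the concrete field
   R[i] gets its usual (modulus) topology by copying the one of R[i]^o. *)
HB.instance Definition _ (R : realType) := PseudoPointedMetric.copy R[i] R[i]^o.
HB.instance Definition _ (R : realType) := NormedModule.copy R[i] R[i]^o.

(* Euclidean balls and spheres of R^n. The topology of 'rV[R]_n is the
   product one; for n = 0 both balls are a point and the sphere is empty. *)
Definition sqnorm (R : realType) n (x : 'rV[R]_n) : R :=
  \sum_(i < n) x ord0 i ^+ 2.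

Definition closed_disc (R : realType) n : set 'rV[R]_n :=
  [set x | sqnorm x <= 1].

Definition open_disc (R : realType) n : set 'rV[R]_n :=
  [set x | sqnorm x < 1].

Definition unit_sphere (R : realType) n : set 'rV[R]_n :=
  [set x | sqnorm x = 1].

(* A finite CW structure on Y, by means of characteristic maps
   D^n -> Y; only the values of char_map on the closed disc matter.
   Closure-finiteness and the weak topology need not be required, as there are
   only finitely many cells. *)
Record finite_CW (R : realType) (Y : topologicalType) := FiniteCW {
  cell : finType;
  cell_dim : cell -> nat;
  char_map : forall e : cell, 'rV[R]_(cell_dim e) -> Y;
  open_cell := fun e : cell => @char_map e @` @open_disc R (cell_dim e);
  CW_hausdorff : hausdorff_space Y;
  char_map_continuous : forall e : cell,
    {within @closed_disc R (cell_dim e), continuous (@char_map e)};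
  (* the next two: char_map is a homeomorphism from the open disc onto the
     open cell, the latter having the topology induced by Y *)
  char_map_inj : forall e : cell,
    set_inj (@open_disc R (cell_dim e)) (@char_map e);
  char_map_open : forall (e : cell) (U : set 'rV[R]_(cell_dim e)), open U ->
    exists2 V : set Y, open V &
      @char_map e @` (U `&` @open_disc R (cell_dim e)) = V `&` open_cell e;
  open_cells_disjoint : trivIset [set: cell] open_cell;
  open_cells_cover : \bigcup_e open_cell e = [set: Y];
  char_map_boundary : forall e : cell,
    @char_map e @` @unit_sphere R (cell_dim e) `<=`
    \bigcup_(e' in [set e' | (cell_dim e' < cell_dim e)%N]) open_cell e'
}.

Definition CW_dim (R : realType) (Y : topologicalType)
  (X : finite_CW R Y) : nat := \max_(e : cell X) cell_dim e.

(* C(Y, M_2). Its *-algebra operations are the pointwise ones. *)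
Definition CM2 (R : realType) (Y : topologicalType) : Type :=
  continuousType Y 'M[R[i]]_2.

Definition cV_norm (R : realType) (v : 'cV[R[i]]_2) : R :=
  Num.sqrt (\sum_(i < 2) ComplexField.Normc.normc (v i ord0) ^+ 2).

(* The C*-norm of M_2, i.e. the operator norm on the Hilbert space C^2. *)
Definition op_norm (R : realType) (A : 'M[R[i]]_2) : R :=
  sup [set cV_norm (A *m v) | v in [set v | cV_norm v <= 1]].

(* The supremum norm of C(Y, M_2); it is applied to continuous functions on
   compact spaces, for which the set of values is bounded. *)
Definition CM2_norm (R : realType) (Y : topologicalType)
  (f : Y -> 'M[R[i]]_2) : R := sup [set op_norm (f y) | y in [set: Y]].

Section Elements.
Variables (R : realType) (Y : topologicalType).
Implicit Types b p : CM2 R Y.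

Definition self_adjoint b : Prop := forall y, b y \is hermsymmx.

Definition CM2_invertible (f : Y -> 'M[R[i]]_2) : Prop :=
  exists c : CM2 R Y, forall y, f y *m c y = 1%:M /\ c y *m f y = 1%:M.

Definition spectrum b : set R[i] :=
  [set l | ~ CM2_invertible (fun y => b y - l%:M)].

Definition projection p : Prop :=
  self_adjoint p /\ forall y, p y *m p y = p y.

Definition rank_one_projection p : Prop :=
  projection p /\ forall y, \rank (p y) = 1%N.

Definition orthogonal_projections p1 p2 : Prop :=
  forall y, p1 y *m p2 y = 0 /\ p2 y *m p1 y = 0.

Definition approx_diagonalizable b : Prop :=
  forall eps : R, 0 < eps ->
  exists (alpha1 alpha2 : continuousType Y R) (p1 p2 : CM2 R Y),
    [/\ rank_one_projection p1, rank_one_projection p2,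
        orthogonal_projections p1 p2 &
        CM2_norm (fun y =>
          b y - ((alpha1 y)%:C *: p1 y + (alpha2 y)%:C *: p2 y)) < eps].

End Elements.

(* Main.v *)
(* Write C^2 = R^4 and let H(w) = 2 w w^* - |w|^2, so that H(w) w = |w|^2 w and
   H(w) = -|w|^2 on the orthogonal line. The element b is H, multiplied by a
   bump function and extended by 0, on a 4-dimensional slice of a top cell.
   If b were within 1 of a1 p1 + a2 p2, then a1 - a2 would have constant sign
   on the 3-sphere where b has eigenvalues 1 and -1, so p = p1 or p = p2 would
   be a field of rank one projections on the 4-disc with p(u) u <> 0 for all u
   in S^3. Parallel transport along rays gives a nowhere zero section v of p,
   and the complex number <u, v(u)> never vanishes on S^3. Dividing v by this
   phase (possible after a deformation, S^3 being simply connected) makes v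
   homotopic to the identity on S^3, which contradicts the no-retraction
   theorem. The latter is proved by a discrete Stokes formula: the cup product
   of the coboundaries of four functions on a cubical grid, summed over all
   Kuhn simplices, only depends on their values on opposite faces. *)

(* The eigenline bundle of H over S^3 is trivial, so the obstruction is not a characteristic class
   on the sphere but the homotopy class of the Hopf map from S^3 to CP^1: the lines p(u), never
   orthogonal to u, are homotopic to the lines through u, yet they would extend over the disc. This
   is why the slice has dimension 4. The tolerance 1 is half the gap between the eigenvalues 1 and
   -1. A top cell is needed because it is open in Y, so that a function supported well inside it
   extends continuously by 0. All homotopies are straight segments in R^4 that avoid 0; each only
   has to be checked on the sphere. The delicate point is the phase <u, v(u)>, which is nonzero on
   the sphere only, while the corrected field must be nonzero on the whole disc. In the
   no-retraction theorem only the signs of the four components are kept, as functions with values 0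
   and 1 on the grid. A nonzero integer sum then yields a small simplex on which all four signs
   change, hence a point where the map is almost 0. *)
Require Import Defs.
From mathcomp Require Import zify ring lra.

Set Implicit Arguments.
Unset Strict Implicit.
Unset Printing Implicit Defensive.
Local Open Scope ring_scope.

(** * Discrete Stokes formula on the grid of dimension 4 *)

(* A Vandermonde product: antisymmetric, 0 on repeated directions, and 12 times
   the signature on permutations. *)
Definition orient (a b c d : 'I_4) : int :=
  (b%:Z - a%:Z) * (c%:Z - a%:Z) * (d%:Z - a%:Z) *
  ((c%:Z - b%:Z) * (d%:Z - b%:Z)) * (d%:Z - c%:Z).

Definition step n (a : 'I_n) : 'rV[nat]_n := delta_mx 0 a.

Definition lattice_pt n K (z : 'rV['I_K]_n) : 'rV[nat]_n :=
  map_mx (@nat_of_ord K) z.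

(** ['I_K.+2] is a cyclic group, so the right-hand sum may be shifted cyclically. The cyclic and the
    true shift differ only where [z 0 a = K.+1]: they reach the coordinates 0 and [K.+2], where both
    terms vanish. *)
Lemma sum_shift n K (a : 'I_n) (G : 'rV[nat]_n -> int) :
  (forall z : 'rV[nat]_n, z 0 a = 0%N -> G z = 0) ->
  (forall z : 'rV[nat]_n, z 0 a = K.+2 -> G z = 0) ->
  \sum_(z : 'rV['I_K.+2]_n) G (lattice_pt z + step a) =
  \sum_(z : 'rV['I_K.+2]_n) G (lattice_pt z).
Proof.
move=> G0 GK.
rewrite [RHS](reindex_inj (@addIr _ (delta_mx 0 a : 'rV['I_K.+2]_n))) /=.
apply: eq_bigr => z _.
have coord j : (lattice_pt z + step a) 0 j = (z 0%R j + (j == a))%N.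
  by rewrite !mxE eqxx natn.
have coord' j : (lattice_pt (z + delta_mx 0 a)) 0 j
    = ((z 0%R j + (j == a)) %% K.+2)%N.
  rewrite !mxE eqxx /=; by case: (j == a).
have [zK|zK] := eqVneq (z 0 a : nat) K.+1.
  rewrite GK ?coord ?eqxx ?zK ?addn1 // G0 // coord' eqxx zK addn1.
  exact: modnn.
congr G; apply/rowP => j; rewrite coord coord' modn_small //.
case: eqP => [->|_]; last by rewrite addn0.
by move: (ltn_ord (z 0 a)) zK; rewrite addn1 => *; lia.
Qed.

Section DiscreteStokes.
Variables (K : nat).
Notation pt := 'rV[nat]_4.
Notation box := 'rV['I_K.+2]_4.

(** A Kuhn simplex runs from the corner of a cube through unit steps in all four directions. Summing
    over all quadruples avoids permutations, as [orient] kills those with a repeated direction. *)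
Definition simplex_sum (T : pt -> pt -> pt -> pt -> pt -> int) : int :=
  \sum_(z : box) \sum_a \sum_b \sum_c \sum_d orient a b c d *
    T (lattice_pt z) (lattice_pt z + step a) (lattice_pt z + step a + step b)
      (lattice_pt z + step a + step b + step c)
      (lattice_pt z + step a + step b + step c + step d).

Lemma simplex_sumB T1 T2 :
  simplex_sum (fun y0 y1 y2 y3 y4 => T1 y0 y1 y2 y3 y4 - T2 y0 y1 y2 y3 y4) =
  simplex_sum T1 - simplex_sum T2.
Proof.
rewrite /simplex_sum -sumrB; apply: eq_bigr => z _.
do 4 (rewrite -sumrB; apply: eq_bigr => ? _).
by rewrite mulrBr.
Qed.

Lemma simplex_sumD T1 T2 :
  simplex_sum (fun y0 y1 y2 y3 y4 => T1 y0 y1 y2 y3 y4 + T2 y0 y1 y2 y3 y4) =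
  simplex_sum T1 + simplex_sum T2.
Proof.
rewrite /simplex_sum -big_split; apply: eq_bigr => z _ /=.
do 4 (rewrite -big_split; apply: eq_bigr => ? _ /=).
by rewrite mulrDr.
Qed.

Lemma eq_simplex_sum T1 T2 :
  (forall y0 y1 y2 y3 y4, T1 y0 y1 y2 y3 y4 = T2 y0 y1 y2 y3 y4) ->
  simplex_sum T1 = simplex_sum T2.
Proof. by move=> eqT; do 5 (apply: eq_bigr => ? _); rewrite eqT. Qed.

(** This inner face is shared by two simplices of opposite orientation, which differ by the exchange
    of [a] and [b]; so the sum equals its opposite. Exchanging [b], [c] or [c], [d] does the same
    for the next two faces. *)
Lemma simplex_sum_drop1 (C : pt -> pt -> pt -> pt -> int) :
  simplex_sum (fun y0 y1 y2 y3 y4 => C y0 y2 y3 y4) = 0.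
Proof.
suff: simplex_sum (fun y0 y1 y2 y3 y4 => C y0 y2 y3 y4) =
     - simplex_sum (fun y0 y1 y2 y3 y4 => C y0 y2 y3 y4) by lia.
rewrite {1}/simplex_sum -sumrN; apply: eq_bigr => z _.
rewrite [LHS]exchange_big -sumrN; apply: eq_bigr => a _.
do 3 (rewrite -sumrN; apply: eq_bigr => ? _).
by rewrite (addrAC _ _ (step a)) -mulNr /orient; congr (_ * _); ring.
Qed.

Lemma simplex_sum_drop2 (C : pt -> pt -> pt -> pt -> int) :
  simplex_sum (fun y0 y1 y2 y3 y4 => C y0 y1 y3 y4) = 0.
Proof.
suff: simplex_sum (fun y0 y1 y2 y3 y4 => C y0 y1 y3 y4) =
     - simplex_sum (fun y0 y1 y2 y3 y4 => C y0 y1 y3 y4) by lia.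
rewrite {1}/simplex_sum -sumrN; apply: eq_bigr => z _.
rewrite -sumrN; apply: eq_bigr => a _.
rewrite [LHS]exchange_big -sumrN; apply: eq_bigr => b _.
do 2 (rewrite -sumrN; apply: eq_bigr => ? _).
by rewrite (addrAC _ _ (step b)) -mulNr /orient; congr (_ * _); ring.
Qed.

Lemma simplex_sum_drop3 (C : pt -> pt -> pt -> pt -> int) :
  simplex_sum (fun y0 y1 y2 y3 y4 => C y0 y1 y2 y4) = 0.
Proof.
suff: simplex_sum (fun y0 y1 y2 y3 y4 => C y0 y1 y2 y4) =
     - simplex_sum (fun y0 y1 y2 y3 y4 => C y0 y1 y2 y4) by lia.
rewrite {1}/simplex_sum -sumrN; apply: eq_bigr => z _.
do 2 (rewrite -sumrN; apply: eq_bigr => ? _).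
rewrite [LHS]exchange_big -sumrN; apply: eq_bigr => c _.
rewrite -sumrN; apply: eq_bigr => ? _.
by rewrite (addrAC _ _ (step c)) -mulNr /orient; congr (_ * _); ring.
Qed.

(** A cochain relative to the boundary of the grid, whose lattice points have coordinates from 0 to
    [K.+2]. *)
Definition vanishes_on_faces (C : pt -> pt -> pt -> pt -> int) :=
  forall (a : 'I_4) m (y0 y1 y2 y3 : pt), m = 0%N \/ m = K.+2 ->
  y0 0 a = m -> y1 0 a = m -> y2 0 a = m -> y3 0 a = m -> C y0 y1 y2 y3 = 0.

(** The face without first vertex, at [z] with directions a, b, c, d, is the face without last
    vertex at [z + step a] with directions b, c, d, a. A 4-cycle is odd, whence the sign. *)
Lemma simplex_sum_drop0 C : vanishes_on_faces C ->
  simplex_sum (fun y0 y1 y2 y3 y4 => C y1 y2 y3 y4) =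
  - simplex_sum (fun y0 y1 y2 y3 y4 => C y0 y1 y2 y3).
Proof.
move=> C0.
have swap (G : box -> 'I_4 -> 'I_4 -> 'I_4 -> 'I_4 -> int) :
    \sum_z \sum_a \sum_b \sum_c \sum_d G z a b c d =
    \sum_a \sum_b \sum_c \sum_d \sum_z G z a b c d.
  rewrite exchange_big; apply: eq_bigr => a _.
  rewrite exchange_big; apply: eq_bigr => b _.
  rewrite exchange_big; apply: eq_bigr => c _.
  by rewrite exchange_big.
rewrite /simplex_sum !swap.
have -> : forall G : 'I_4 -> 'I_4 -> 'I_4 -> 'I_4 -> int,
    \sum_a \sum_b \sum_c \sum_d G a b c d =
    \sum_b \sum_c \sum_d \sum_a G a b c d.
  move=> G; rewrite exchange_big; apply: eq_bigr => b _.
  by rewrite exchange_big; apply: eq_bigr => c _; rewrite exchange_big.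
rewrite -sumrN; apply: eq_bigr => b _; rewrite -sumrN; apply: eq_bigr => c _.
rewrite -sumrN; apply: eq_bigr => d _; rewrite -sumrN; apply: eq_bigr => a _.
rewrite -!mulr_sumr -mulNr.
have -> : orient a b c d = - orient b c d a by rewrite /orient; ring.
have [->|nz] := eqVneq (orient b c d a) 0; first by rewrite oppr0 !mul0r.
congr (_ * _).
(* As [a] differs from [b], [c] and [d], the four vertices in [G] have the same coordinate [a], so
   they lie on a common face as soon as one of them does. *)
have nab : [/\ a != b, a != c & a != d].
  by split; apply: contraNneq nz => <-; rewrite /orient !subrr !(mul0r, mulr0).
pose G y := C y (y + step b) (y + step b + step c) (y + step b + step c + step
  d).
have [/negPf nb /negPf nc /negPf nd] := nab.
have G0 m (y : pt) : m = 0%N \/ m = K.+2 -> y 0 a = m -> G y = 0.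
  by move=> m0K ya; apply: (C0 a m) => //; rewrite !mxE ?nb ?nc ?nd /= ?addr0.
by rewrite -(@sum_shift _ _ a G) // => y; apply: G0; [left|right].
Qed.

Lemma discrete_stokes C : vanishes_on_faces C ->
  simplex_sum (fun y0 y1 y2 y3 y4 => C y1 y2 y3 y4 - C y0 y2 y3 y4 +
    C y0 y1 y3 y4 - C y0 y1 y2 y4 + C y0 y1 y2 y3) = 0.
Proof.
move=> C0.
transitivity (simplex_sum (fun y0 y1 y2 y3 y4 => C y1 y2 y3 y4) -
  simplex_sum (fun y0 y1 y2 y3 y4 => C y0 y2 y3 y4) +
  simplex_sum (fun y0 y1 y2 y3 y4 => C y0 y1 y3 y4) -
  simplex_sum (fun y0 y1 y2 y3 y4 => C y0 y1 y2 y4) +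
  simplex_sum (fun y0 y1 y2 y3 y4 => C y0 y1 y2 y3)).
  by rewrite -simplex_sumB -simplex_sumD -simplex_sumB -simplex_sumD.
rewrite simplex_sum_drop0 // simplex_sum_drop1 simplex_sum_drop2.
by rewrite simplex_sum_drop3 subr0 addr0 subr0 addNr.
Qed.

(* The cup product of the coboundaries of f1, f2, f3, f4 on a simplex. *)
Definition cup4 (f1 f2 f3 f4 : pt -> int) (y0 y1 y2 y3 y4 : pt) : int :=
  (f1 y1 - f1 y0) * (f2 y2 - f2 y1) * (f3 y3 - f3 y2) * (f4 y4 - f4 y3).

Definition same_on_faces (a : 'I_4) (f g : pt -> int) :=
  forall y : pt, y 0 a = 0%N \/ y 0 a = K.+2 -> f y = g y.

Definition faces_cst (a : 'I_4) (f : pt -> int) :=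
  forall y y' : pt, y 0 a = y' 0 a -> y 0 a = 0%N \/ y 0 a = K.+2 -> f y = f y'.

Lemma ord4_ind (P : 'I_4 -> Prop) :
  P 0 -> P 1 -> P 2%:R -> P 3%:R -> forall a, P a.
Proof.
move=> P0 P1 P2 P3 [[|[|[|[|//]]]] lta].
- by rewrite (_ : Ordinal lta = 0) //; exact: val_inj.
- by rewrite (_ : Ordinal lta = 1) //; exact: val_inj.
- by rewrite (_ : Ordinal lta = 2%:R) //; exact: val_inj.
- by rewrite (_ : Ordinal lta = 3%:R) //; exact: val_inj.
Qed.

(** The functions are replaced one at a time. Each replacement changes the cup product by the
    coboundary, up to sign, of a 3-cochain with a difference such as [f1 - g1] in place of one
    coboundary. It vanishes on the boundary: on faces orthogonal to its own axis by the difference,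
    on the others because a coboundary is 0 where the function is constant. *)
Lemma simplex_sum_cup4 f1 f2 f3 f4 g1 g2 g3 g4 :
  faces_cst 0 f1 -> faces_cst 1 f2 -> faces_cst 2%:R f3 -> faces_cst 3%:R f4 ->
  faces_cst 0 g1 -> faces_cst 1 g2 -> faces_cst 2%:R g3 -> faces_cst 3%:R g4 ->
  same_on_faces 0 f1 g1 -> same_on_faces 1 f2 g2 ->
  same_on_faces 2%:R f3 g3 -> same_on_faces 3%:R f4 g4 ->
  simplex_sum (cup4 f1 f2 f3 f4) = simplex_sum (cup4 g1 g2 g3 g4).
Proof.
move=> cf1 cf2 cf3 cf4 cg1 cg2 cg3 cg4 e1 e2 e3 e4.
transitivity (simplex_sum (cup4 g1 f2 f3 f4)).
  apply/eqP; rewrite -subr_eq0 -simplex_sumB; apply/eqP.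
  rewrite -(@discrete_stokes (fun y0 y1 y2 y3 => (f1 y0 - g1 y0) *
    (f2 y1 - f2 y0) * (f3 y2 - f3 y1) * (f4 y3 - f4 y2))).
    by apply: eq_simplex_sum => y0 y1 y2 y3 y4; rewrite /cup4; ring.
  elim/ord4_ind => m y0 y1 y2 y3 m0K m0 m1 m2 m3.
  - by rewrite e1 ?m0 // subrr !mul0r.
  - by rewrite (cf2 y1 y0) ?m1 // subrr mulr0 !mul0r.
  - by rewrite (cf3 y2 y1) ?m2 // subrr mulr0 !mul0r.
  - by rewrite (cf4 y3 y2) ?m3 // subrr mulr0.
transitivity (simplex_sum (cup4 g1 g2 f3 f4)).
  (* The difference now stands after one coboundary, so the Leibniz rule brings a minus sign,
     absorbed by exchanging the two sides. *)
  apply/eqP; rewrite eq_sym -subr_eq0 -simplex_sumB; apply/eqP.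
  rewrite -(@discrete_stokes (fun y0 y1 y2 y3 => (g1 y1 - g1 y0) *
    (f2 y1 - g2 y1) * (f3 y2 - f3 y1) * (f4 y3 - f4 y2))).
    by apply: eq_simplex_sum => y0 y1 y2 y3 y4; rewrite /cup4; ring.
  elim/ord4_ind => m y0 y1 y2 y3 m0K m0 m1 m2 m3.
  - by rewrite (cg1 y1 y0) ?m1 // subrr !mul0r.
  - by rewrite e2 ?m1 // subrr mulr0 !mul0r.
  - by rewrite (cf3 y2 y1) ?m2 // subrr mulr0 !mul0r.
  - by rewrite (cf4 y3 y2) ?m3 // subrr mulr0.
transitivity (simplex_sum (cup4 g1 g2 g3 f4)).
  apply/eqP; rewrite -subr_eq0 -simplex_sumB; apply/eqP.
  rewrite -(@discrete_stokes (fun y0 y1 y2 y3 => (g1 y1 - g1 y0) *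
    (g2 y2 - g2 y1) * (f3 y2 - g3 y2) * (f4 y3 - f4 y2))).
    by apply: eq_simplex_sum => y0 y1 y2 y3 y4; rewrite /cup4; ring.
  elim/ord4_ind => m y0 y1 y2 y3 m0K m0 m1 m2 m3.
  - by rewrite (cg1 y1 y0) ?m1 // subrr !mul0r.
  - by rewrite (cg2 y2 y1) ?m2 // subrr mulr0 !mul0r.
  - by rewrite e3 ?m2 // subrr mulr0 !mul0r.
  - by rewrite (cf4 y3 y2) ?m3 // subrr mulr0.
apply/eqP; rewrite eq_sym -subr_eq0 -simplex_sumB; apply/eqP.
rewrite -(@discrete_stokes (fun y0 y1 y2 y3 => (g1 y1 - g1 y0) *
  (g2 y2 - g2 y1) * (g3 y3 - g3 y2) * (f4 y3 - g4 y3))).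
  by apply: eq_simplex_sum => y0 y1 y2 y3 y4; rewrite /cup4; ring.
elim/ord4_ind => m y0 y1 y2 y3 m0K m0 m1 m2 m3.
- by rewrite (cg1 y1 y0) ?m1 // subrr !mul0r.
- by rewrite (cg2 y2 y1) ?m2 // subrr mulr0 !mul0r.
- by rewrite (cg3 y3 y2) ?m3 // subrr mulr0 !mul0r.
- by rewrite e4 ?m3 // subrr mulr0.
Qed.

Definition posc (a : 'I_4) (y : pt) : int := (0 < y 0%R a)%N.

(** These functions jump only between the coordinates 0 and 1, so only the simplex at the corner 0
    with increasing directions contributes: its cup product is 1 and its [orient] is 12. *)
Lemma simplex_sum_posc :
  simplex_sum (cup4 (posc 0) (posc 1) (posc 2%:R) (posc 3%:R)) = 12.
Proof.
have poscS a b (y : pt) : posc a (y + step b) - posc a y =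
   ((b == a) && (y 0 a == 0%N))%:R.
  rewrite /posc !mxE eqxx natn /= [a == b]eq_sym.
  by case: (b == a) => /=; rewrite ?addn1 ?addn0 ?subrr //; case: (y 0 a).
have cupE (z : box) a b c d : orient a b c d *
    cup4 (posc 0) (posc 1) (posc 2%:R) (posc 3%:R) (lattice_pt z)
      (lattice_pt z + step a) (lattice_pt z + step a + step b)
      (lattice_pt z + step a + step b + step c)
      (lattice_pt z + step a + step b + step c + step d) =
    if [&& z == 0, a == 0, b == 1, c == 2%:R & d == 3%:R] then 12 else 0.
  case: ifPn => [/and5P[/eqP-> /eqP-> /eqP-> /eqP-> /eqP->]|].
    by rewrite /cup4 !poscS !mxE.
  move=> nz; rewrite /cup4 !poscS.
  have [ea|na] := eqVneq a 0; last by rewrite !mul0r mulr0.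
  have [eb|nb] := eqVneq b 1; last by rewrite mulr0 !mul0r mulr0.
  have [ec|nc] := eqVneq c 2%:R; last by rewrite mulr0 !mul0r mulr0.
  have [ed|nd] := eqVneq d 3%:R; last by rewrite !mulr0.
  rewrite ea eb ec !mxE /= ?addr0.
  have [z0|_] := eqVneq (z 0 0 : nat) 0%N; last by rewrite !mul0r mulr0.
  have [z1|_] := eqVneq (z 0 1 : nat) 0%N; last by rewrite mulr0 !mul0r mulr0.
  have [z2|_] := eqVneq (z 0 2%:R : nat) 0%N; last by rewrite mulr0 !mul0r
    mulr0.
  have [z3|_] := eqVneq (z 0 3%:R : nat) 0%N; last by rewrite !mulr0.
  case/negP: nz; rewrite ea eb ec ed !eqxx !andbT; apply/eqP/rowP => j.
  by elim/ord4_ind: j; apply: val_inj; rewrite /= mxE ?(z0, z1, z2, z3).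
rewrite /simplex_sum (bigD1 0) //= [X in _ + X]big1 ?addr0; last first.
  move=> z /negPf nz; do 4 (apply: big1 => ? _); by rewrite cupE nz.
rewrite (bigD1 0) //= [X in _ + X]big1 ?addr0; last first.
  move=> a /negPf nz; do 3 (apply: big1 => ? _); by rewrite cupE nz andbF.
rewrite (bigD1 1) //= [X in _ + X]big1 ?addr0; last first.
  move=> a /negPf nz; do 2 (apply: big1 => ? _); by rewrite cupE nz !andbF.
rewrite (bigD1 2%:R) //= [X in _ + X]big1 ?addr0; last first.
  move=> a /negPf nz; apply: big1 => ? _; by rewrite cupE nz !andbF.
rewrite (bigD1 3%:R) //= [X in _ + X]big1 ?addr0; last first.
  by move=> a /negPf nz; rewrite cupE nz !andbF.
by rewrite cupE !eqxx.
Qed.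

Definition near_pt (k : nat) (z y : pt) :=
  forall j, (z 0%R j <= y 0%R j <= z 0%R j + k)%N.

Lemma near_ptS k z y b : near_pt k z y -> near_pt k.+1 z (y + step b).
Proof.
move=> zy j; have -> : (y + step b) 0 j = (y 0%R j + (j == b))%N.
  by rewrite !mxE natn.
by have := zy j; case: (j == b); lia.
Qed.

Lemma near_ptW k k' z y : (k <= k')%N -> near_pt k z y -> near_pt k' z y.
Proof. by move=> kk' zy j; have := zy j; lia. Qed.

(** A discrete Poincare-Miranda theorem. The boundary values force the sum 12, so some simplex has a
    nonzero cup product, and each factor of that product is a jump of one [f a]. Its vertices are at
    most four steps away from [z]. *)
Lemma sign_change_cell (f : 'I_4 -> pt -> int) :
  (forall a (y : pt), y 0 a = 0%N -> f a y = 0) ->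
  (forall a (y : pt), y 0 a = K.+2 -> f a y = 1) ->
  exists2 z : pt, forall j, (z 0%R j < K.+2)%N &
    forall a, exists y y', [/\ near_pt 4 z y, near_pt 4 z y' & f a y != f a y'].
Proof.
move=> f0 fK.
have posc_cst a : faces_cst a (posc a) by move=> y y' yy' _; rewrite /posc yy'.
have f_cst a : faces_cst a (f a).
  move=> y y' yy' [y0|yK]; first by rewrite !f0 // -yy'.
  by rewrite !fK // -yy'.
have f_posc a : same_on_faces a (f a) (posc a).
  by move=> y [ya|ya]; rewrite ?(f0 _ _ ya) ?(fK _ _ ya) /posc ya.
have := simplex_sum_posc; rewrite -(@simplex_sum_cup4 (f 0) (f 1) (f 2%:R) (f
  3%:R)) //.
move=> S12.
apply: contrapT => nex; suff : simplex_sum (cup4 (f 0) (f 1) (f 2%:R) (f 3%:R))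
  = 0.
  by rewrite S12.
apply: big1 => z _; apply: big1 => b1 _; apply: big1 => b2 _.
apply: big1 => b3 _; apply: big1 => b4 _.
apply/eqP; apply: contra_notT nex; rewrite !mulf_eq0 !subr_eq0 !negb_or.
move=> /andP[_ /andP[/andP[/andP[d1 d2] d3] d4]].
set z0 := lattice_pt z in d1 d2 d3 d4 *.
have near0 : near_pt 0 z0 z0 by move=> j; lia.
exists z0; first by move=> j; rewrite mxE.
have near1 b := near_ptS b near0; have near2 b b' := near_ptS b' (near1 b).
have near3 b b' b'' := near_ptS b'' (near2 b b').
have near4 b b' b'' b3 := near_ptS b3 (near3 b b' b'').
elim/ord4_ind.
- exists (z0 + step b1), z0.
  by split=> //; [exact: near_ptW (near1 _)|exact: near_ptW near0].
- exists (z0 + step b1 + step b2), (z0 + step b1).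
  by split=> //; [exact: near_ptW (near2 _ _)|exact: near_ptW (near1 _)].
- exists (z0 + step b1 + step b2 + step b3), (z0 + step b1 + step b2).
  by split=> //; [exact: near_ptW (near3 _ _ _)|exact: near_ptW (near2 _ _)].
- exists (z0 + step b1 + step b2 + step b3 + step b4),
    (z0 + step b1 + step b2 + step b3).
  by split=> //; exact: near_ptW (near3 _ _ _).
Qed.
End DiscreteStokes.

(** * The no-retraction theorem *)

Lemma cts_comp (T S U : topologicalType) (f : T -> S) (g : S -> U) :
  continuous f -> continuous g -> continuous (fun x => g (f x)).
Proof. by move=> cf cg x; apply: (@continuous_comp _ _ _ f g);
  [exact: cf|exact: cg]. Qed.

Lemma continuous_mx (T S : topologicalType) m n (f : T -> 'M[S]_(m, n)) :
  (forall i j, continuous (fun x => f x i j)) -> continuous f.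
Proof.
move=> cf x A [P Px PA]; rewrite /nbhs /=.
have : \forall y \near x, forall ij : 'I_m * 'I_n, P ij.1 ij.2 (f y ij.1 ij.2).
  by apply: filter_forall => -[i j]; exact: cf.
by apply: filterS => y Py; apply: PA => i j; exact: (Py (i, j)).
Qed.

Section EuclideanSpace.
Variable R : realType.

Lemma coord_le_sqnorm n (x : 'rV[R]_n) j : x 0 j ^+ 2 <= sqnorm x.
Proof.
rewrite /sqnorm (bigD1 j) //= lerDl sumr_ge0 // => i _; exact: sqr_ge0.
Qed.

Lemma sqnorm_ge0 n (x : 'rV[R]_n) : 0 <= sqnorm x.
Proof. by apply: sumr_ge0 => i _; exact: sqr_ge0. Qed.

Lemma sqnorm_eq0 n (x : 'rV[R]_n) : (sqnorm x == 0) = (x == 0).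
Proof.
apply/eqP/eqP => [x0|->]; last first.
  by rewrite /sqnorm big1 // => i _; rewrite mxE expr0n.
apply/rowP => j; rewrite mxE; apply/eqP; rewrite -sqrf_eq0 eq_le sqr_ge0 andbT.
by rewrite -x0 coord_le_sqnorm.
Qed.

Lemma sqnormZ n (c : R) (x : 'rV[R]_n) : sqnorm (c *: x) = c ^+ 2 * sqnorm x.
Proof.
by rewrite /sqnorm mulr_sumr; apply: eq_bigr => i _; rewrite mxE exprMn.
Qed.

Lemma ctsD (T : topologicalType) (f g : T -> R) :
  continuous f -> continuous g -> continuous (fun x => f x + g x).
Proof. by move=> cf cg x; apply: continuousD; [exact: cf|exact: cg]. Qed.

Lemma cts_id (T : topologicalType) : continuous (fun x : T => x).
Proof. by move=> x; exact: cvg_id. Qed.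

Lemma ctsN (T : topologicalType) (f : T -> R) :
  continuous f -> continuous (fun x => - f x).
Proof. by move=> cf x; apply: continuousN; exact: cf. Qed.

Lemma ctsM (T : topologicalType) (f g : T -> R) :
  continuous f -> continuous g -> continuous (fun x => f x * g x).
Proof. by move=> cf cg x; apply: continuousM; [exact: cf|exact: cg]. Qed.

Lemma ctsX (T : topologicalType) (f : T -> R) n :
  continuous f -> continuous (fun x => f x ^+ n).
Proof.
move=> cf; elim: n => [|n ih]; first exact: cst_continuous.
by under eq_fun do rewrite exprS; exact: ctsM.
Qed.

Lemma ctsV (T : topologicalType) (f : T -> R) : (forall x, f x != 0) ->
  continuous f -> continuous (fun x => (f x)^-1).
Proof. by move=> f0 cf x; apply: continuousV; [exact: f0|exact: cf]. Qed.

Lemma cts_max (T : topologicalType) (f g : T -> R) :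
  continuous f -> continuous g -> continuous (fun x => Num.max (f x) (g x)).
Proof. by move=> cf cg x; apply: continuous_max; [exact: cf|exact: cg]. Qed.

Lemma cts_sqrt (T : topologicalType) (f : T -> R) :
  continuous f -> continuous (fun x => Num.sqrt (f x)).
Proof.
by move=> cf x; apply: continuous_comp; [exact: cf|exact: sqrt_continuous].
Qed.

Lemma cts_coord (T : topologicalType) m n (f : T -> 'M[R]_(m, n)) i j :
  continuous f -> continuous (fun x => f x i j).
Proof.
move=> cf x; apply: (@continuous_comp _ _ _ f (fun A : 'M[R]_(m, n) => A i j)).
  exact: cf.
exact: coord_continuous.
Qed.

Lemma continuous_sum (T : topologicalType) (I : finType) (f : I -> T -> R) :
  (forall i, continuous (f i)) -> continuous (fun x => \sum_i f i x).
Proof.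
move=> cf; rewrite (_ : (fun x => _) = \sum_i f i); last first.
  by apply/funext => x; rewrite fct_sumE.
elim/big_ind: _ => [|g h cg ch|i _]; [exact: cst_continuous|exact: ctsD|exact: cf].
Qed.

Lemma cts_sqnorm (T : topologicalType) n (f : T -> 'rV[R]_n) :
  continuous f -> continuous (fun x => sqnorm (f x)).
Proof. by move=> cf; apply: continuous_sum => i; apply: ctsX; exact: cts_coord.
Qed.

Lemma ctsZ (T : topologicalType) m n (c : T -> R) (f : T -> 'M[R]_(m, n)) :
  continuous c -> continuous f -> continuous (fun x => c x *: f x).
Proof.
move=> cc cf; apply: continuous_mx => i j; under eq_fun do rewrite mxE.
by apply: ctsM => //; exact: cts_coord.
Qed.

Lemma cts_mxD (T : topologicalType) m n (f g : T -> 'M[R]_(m, n)) :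
  continuous f -> continuous g -> continuous (fun x => f x + g x).
Proof.
move=> cf cg; apply: continuous_mx => i j; under eq_fun do rewrite mxE.
by apply: ctsD => //; exact: cts_coord.
Qed.

Lemma compact_cube n (r : R) : compact [set x : 'rV[R]_n | forall j,
  `|x 0 j| <= r].
Proof.
have := @rV_compact R n (fun _ => `[-r, r]%classic) (fun _ =>
  @segment_compact _ _ _).
congr compact; apply/seteqP; split=> x /= xr j; have := xr j;
  rewrite /= in_itv /=; by rewrite ler_norml.
Qed.

Lemma compact_disc n (r : R) : compact [set x : 'rV[R]_n | sqnorm x <= r].
Proof.
apply: (subclosed_compact _ (@compact_cube n (r + 1))).
  rewrite (_ : [set _ | _] = @sqnorm R n @^-1` [set t | t <= r]) //.
  apply: preimage_closed; [by move=> x _; exact: (cts_sqnorm (@cts_id _))|exact: closed_le].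
move=> x /= xr j; have := le_trans (coord_le_sqnorm x j) xr.
rewrite ler_norml => ?; nra.
Qed.

(** Only [x] is confined to [K], so nearby grid points need not be shown to stay in the cube. *)
Lemma unif_continuous_on_compact n (K : set 'rV[R]_n) (f : 'rV[R]_n ->
  R) (e : R) :
  compact K -> continuous f -> 0 < e ->
  exists2 d : R, 0 < d & forall x y : 'rV_n, K x ->
    (forall j, `|x 0 j - y 0 j| < d) ->
    `|f x - f y| < e.
Proof.
move=> /compact_near_coveringP cK cf e0.
have : \forall d \near 0^'+, K `<=` (fun x : 'rV[R]_n => forall y : 'rV[R]_n,
    (forall j, `|x 0 j - y 0 j| < d) -> `|f x - f y| < e).
  apply: cK => x Kx.
  have e20 : 0 < e / 2 by rewrite divr_gt0.
  have /cvgrPdist_lt /(_ _ e20) /nbhs_ballP [d /= d0 fd] := cf x.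
  have d20 : 0 < d / 2 by rewrite divr_gt0.
  exists (ball x (d / 2), [set t | t < d / 2]).
    split; first exact: nbhsx_ballx.
    exact: nbhs_right_lt.
  move=> [x' t] [/= [_ xx'] td] y x'y.
  rewrite (splitr e) (le_lt_trans (ler_distD (f x) _ _)) // ltrD //.
    rewrite distrC; apply: fd; split=> // i j; rewrite ord1.
    by apply: le_ball (xx' 0 j); lra.
  apply: fd; split=> // i j; rewrite ord1 /=.
  apply: le_lt_trans (ler_distD (x' 0 j) _ _) _; rewrite (splitr d) ltrD //.
    exact: (xx' 0 j).
  exact: lt_trans (x'y j) td.
move=> near_d; have [d [d0 Kd]] := filter_ex (filterI (nbhs_right_gt 0) near_d).
by exists d => // x y Kx; exact: Kd.
Qed.

Lemma sum_ord4 (V : nmodType) (F : 'I_4 -> V) :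
  \sum_i F i = F 0 + F 1 + F 2%:R + F 3%:R.
Proof.
rewrite !big_ord_recl big_ord0 addr0 !addrA.
by congr (F _ + F _ + F _ + F _); exact: val_inj.
Qed.

Lemma sqnorm4 (x : 'rV[R]_4) :
  sqnorm x = x 0 0 ^+ 2 + x 0 1 ^+ 2 + x 0 2%:R ^+ 2 + x 0 3%:R ^+ 2.
Proof. exact: sum_ord4. Qed.

Definition normalize n (x : 'rV[R]_n) : 'rV[R]_n :=
  (Num.sqrt (sqnorm x))^-1 *: x.

Lemma sqnorm_normalize n (x : 'rV[R]_n) : x != 0 -> sqnorm (normalize x) = 1.
Proof.
move=> x0; rewrite sqnormZ exprVn sqr_sqrtr ?sqnorm_ge0 // mulVf //.
by rewrite sqnorm_eq0.
Qed.

Lemma normalize_id n (x : 'rV[R]_n) : sqnorm x = 1 -> normalize x = x.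
Proof. by move=> x1; rewrite /normalize x1 sqrtr1 invr1 scale1r. Qed.

(** The nearest-point projection onto the closed disc. Precomposition with it turns maps that matter
    on the disc only into continuous maps on R^n. *)
Definition retract n (x : 'rV[R]_n) : 'rV[R]_n :=
  (Num.sqrt (Num.max 1 (sqnorm x)))^-1 *: x.

Lemma retract_continuous n : continuous (@retract n).
Proof.
apply: ctsZ (@cts_id _); apply: ctsV.
  by move=> x; rewrite gt_eqF // sqrtr_gt0 lt_max ltr01.
apply: cts_sqrt; apply: cts_max (@cst_continuous _ _ _) _.
exact: cts_sqnorm (@cts_id _).
Qed.

Lemma retract_sphere n (x : 'rV[R]_n) : 1 <= sqnorm x -> sqnorm (retract x) = 1.
Proof.
move=> x1; rewrite sqnormZ exprVn sqr_sqrtr ?le_max ?ler01 // max_r // mulVf //.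
by rewrite gt_eqF // (lt_le_trans ltr01).
Qed.

Lemma retract_id n (x : 'rV[R]_n) : sqnorm x <= 1 -> retract x = x.
Proof. by move=> x1; rewrite /retract max_l // sqrtr1 invr1 scale1r. Qed.

Lemma retract_disc n (x : 'rV[R]_n) : sqnorm (retract x) <= 1.
Proof.
have [x1|/ltW x1] := leP (sqnorm x) 1; first by rewrite retract_id.
by rewrite retract_sphere.
Qed.

(** On the faces of the cube, which lie outside the open disc, [F x] is a positive multiple of [x],
    so its components have the signs required by [sign_change_cell]. Where all four change sign, all
    four are small, below the minimum of the norm. *)
Lemma no_retraction (G : 'rV[R]_4 -> 'rV[R]_4) : continuous G ->
  (forall x, sqnorm x <= 1 -> G x != 0) ->
  (forall x, sqnorm x = 1 -> G x = x) -> False.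
Proof.
move=> cG G0 Gid; pose F x := G (retract x).
have cF : continuous F.
  exact: cts_comp (@retract_continuous 4) cG.
have F0 x : 0 < sqnorm (F x) by rewrite lt_def sqnorm_eq0 sqnorm_ge0 G0 //
  retract_disc.
pose cube := [set x : 'rV[R]_4 | forall j, `|x 0 j| <= 1].
have ccube : compact cube := @compact_cube 4 1.
have [c _ Fc] : exists2 c, c \in cube & forall t, t \in cube ->
  sqnorm (F c) <= sqnorm (F t).
  apply: EVT_min_rV => //.
    by exists 0 => j; rewrite mxE normr0.
  by apply: continuous_subspaceT; exact: cts_sqnorm.
(* Since [eta <= 1], also [eta ^+ 2 <= eta], so four squares below [eta ^+ 2] add up to less than
   the minimum [sqnorm (F c)]. *)
pose eta := Num.min 1 (sqnorm (F c) / 4).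
have eta0 : 0 < eta by rewrite lt_min ltr01 divr_gt0.
have eta2 : 4 * eta ^+ 2 <= sqnorm (F c).
  have : eta <= 1 by rewrite ge_min lexx.
  have : eta <= sqnorm (F c) / 4 by rewrite ge_min lexx orbT.
  move: (F0 c); nra.
have [d d0 Fd] : exists2 d : R, 0 < d & forall a (x y : 'rV_4), cube x ->
    (forall j, `|x 0 j - y 0 j| < d) -> `|F x 0 a - F y 0 a| < eta.
  have /choice[d Hd] a : exists d : R, 0 < d /\ forall x y : 'rV_4, cube x ->
    (forall j, `|x 0 j - y 0 j| < d) -> `|F x 0 a - F y 0 a| < eta.
    by have [d] := unif_continuous_on_compact ccube (@cts_coord _ _ _ F 0 a cF)
      eta0; exists d.
  exists (\big[Num.min/1]_a d a).
    by apply: lt_bigmin => // a _; exact: (Hd a).1.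
  move=> a x y cx xy; apply: (Hd a).2 => // j; apply: lt_le_trans (xy j) _.
  exact: bigmin_le.
(* The mesh is 2 / (K + 2), and four steps must stay below [d]. *)
have [K Kd] : exists K : nat, 8 < d * (K.+2)%:R.
  exists (Num.bound (8 / d)); rewrite mulrC -ltr_pdivrMr //.
  apply: lt_le_trans (archi_boundP _) _; first by rewrite divr_ge0 // ltW.
  by rewrite ler_nat leqW.
have K0 : (K.+2)%:R != 0 :> R by rewrite pnatr_eq0.
have K0' : 0 < (K.+2)%:R :> R by rewrite ltr0n.
pose pt (y : 'rV[nat]_4) : 'rV[R]_4 := \row_j (2 * (y 0 j)%:R / (K.+2)%:R - 1).
pose f a (y : 'rV[nat]_4) : int := (0 < F (pt y) 0 a).
have Fface (x : 'rV[R]_4) a : x 0 a ^+ 2 = 1 ->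
    exists2 k, 0 < k & F x 0 a = k * x 0 a.
  move=> xa; have x1 : 1 <= sqnorm x by rewrite -xa coord_le_sqnorm.
  rewrite /F Gid ?retract_sphere // mxE; eexists; last by [].
  by rewrite invr_gt0 sqrtr_gt0 lt_max ltr01.
have [z zK fz] : exists2 z : 'rV[nat]_4, forall j, (z 0%R j < K.+2)%N &
    forall a, exists y y', [/\ near_pt 4 z y, near_pt 4 z y' & f a y != f a y'].
  apply: sign_change_cell => a y ya.
  - have pya : pt y 0 a = -1 by rewrite mxE ya mulr0 mul0r add0r.
    have [|k k0] := Fface (pt y) a; first by rewrite pya sqrrN expr1n.
    by rewrite /f pya => ->; rewrite mulrN1 oppr_gt0 ltNge ltW.
  - have pya : pt y 0 a = 1 by rewrite mxE ya mulfK //; lra.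
    have [|k k0] := Fface (pt y) a; first by rewrite pya expr1n.
    by rewrite /f pya => ->; rewrite mulr1 k0.
have cz : cube (pt z).
  move=> j; rewrite mxE ler_norml; apply/andP; split.
    by rewrite lerBrDl addrN divr_ge0 // ?mulr_ge0 // ltW.
  rewrite lerBlDr ler_pdivrMr // -natrM -[1 + 1]/2%:R -natrM ler_nat.
  by have := zK j; lia.
have zy (y : 'rV[nat]_4) j : near_pt 4 z y -> `|pt z 0 j - pt y 0 j| < d.
  move=> /(_ j) /andP[zy1 zy2].
  have -> : pt z 0 j - pt y 0 j = - (2 * (y 0%R j - z 0%R j)%:R / (K.+2)%:R).
    by rewrite !mxE natrB //; field.
  rewrite normrN ger0_norm ?divr_ge0 ?mulr_ge0 //.
  rewrite ltr_pdivrMr // (le_lt_trans _ Kd) // -natrM ler_nat; lia.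
have Fz a : `|F (pt z) 0 a| < eta.
  have [y [y' [zy1 zy2]]] := fz a; rewrite /f.
  have := Fd a _ _ cz (fun j => zy _ j zy1).
  have := Fd a _ _ cz (fun j => zy _ j zy2).
  rewrite !ltr_norml => /andP[? ?] /andP[? ?].
  case: (ltP 0 (F (pt y) 0 a)); case: (ltP 0 (F (pt y') 0 a)) => ? ? // _;
    by apply/andP; split; lra.
have Fz2 a : F (pt z) 0 a ^+ 2 < eta ^+ 2.
  by rewrite -real_normK ?num_real // ltrXn2r ?nnegrE // ltW.
have := Fc (pt z); rewrite inE => /(_ cz); apply/negP; rewrite -ltNge.
apply: lt_le_trans eta2; rewrite sqnorm4.
by move: (Fz2 0) (Fz2 1) (Fz2 2%:R) (Fz2 3%:R); lra.
Qed.
End EuclideanSpace.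

(** * Coordinates in R^4 *)

Section Vec4.
Variable R : realType.
Notation E := 'rV[R]_4.

Definition vec4 (a b c d : R) : E := \row_j nth 0 [:: a; b; c; d] j.

Lemma vec4E a b c d : (vec4 a b c d 0 0 = a) * (vec4 a b c d 0 1 = b) *
  (vec4 a b c d 0 2%:R = c) * (vec4 a b c d 0 3%:R = d).
Proof. by rewrite !mxE. Qed.

Lemma rowDE (x y : E) j : (x + y) 0 j = x 0 j + y 0 j. Proof. by rewrite mxE.
Qed.
Lemma rowBE (x y : E) j : (x - y) 0 j = x 0 j - y 0 j. Proof. by rewrite !mxE.
Qed.
Lemma rowZE a (x : E) j : (a *: x) 0 j = a * x 0 j. Proof. by rewrite mxE. Qed.
Lemma row0E j : (0 : E) 0 j = 0. Proof. by rewrite mxE. Qed.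

Lemma row4P (x y : E) : x 0 0 = y 0 0 -> x 0 1 = y 0 1 -> x 0 2%:R = y 0 2%:R ->
  x 0 3%:R = y 0 3%:R -> x = y.
Proof. by move=> *; apply/rowP; exact: ord4_ind. Qed.

Lemma cts_vec4 (T : topologicalType) (a b c d : T -> R) :
  continuous a -> continuous b -> continuous c -> continuous d ->
  continuous (fun x => vec4 (a x) (b x) (c x) (d x)).
Proof.
move=> ca cb cc cd; apply: continuous_mx => i; rewrite ord1.
by apply: ord4_ind; under eq_fun do rewrite vec4E.
Qed.
End Vec4.

Ltac cts := first [assumption | lazymatch goal with
  | |- continuous ?f => lazymatch f with
    | (fun y => y) => exact: cts_id
    | (fun y => (@?g y + @?h y)%R) => apply: (@ctsD _ _ g h); cts
    | (fun y => (- @?g y)%R) => apply: (@ctsN _ _ g); cts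
    | (fun y => (@?g y * @?h y)%R) => apply: (@ctsM _ _ g h); cts
    | (fun y => (@?g y ^+ ?n)%R) => apply: (@ctsX _ _ g n); cts
    | (fun y => Order.max (@?g y) (@?h y)) => apply: (@cts_max _ _ g h); cts
    | (fun y => Num.sqrt (@?g y)) => apply: (@cts_sqrt _ _ g); cts
    | (fun y => sqnorm (@?g y)) => apply: (@cts_sqnorm _ _ _ g); cts
    | (fun y => fun_of_matrix (@?g y) ?i ?j) =>
        apply: (@cts_coord _ _ _ _ g i j); cts
    | _ => exact: cst_continuous
    end
  end].

(** * Fields of lines transverse to the tautological one *)

Section C2.
Variable R : realType.
Notation E := 'rV[R]_4.

(** [G], run at double speed, fills the disc of radius 1/2, where [s] is 0; the collar, where [r]
    lies on the sphere, carries the segment from [G] to [g]. *)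
Lemma homotopic_extension n (G g : 'rV[R]_n -> 'rV[R]_n) :
  continuous G -> continuous g ->
  (forall x, sqnorm x <= 1 -> G x != 0) ->
  (forall u s, sqnorm u = 1 -> 0 <= s <= 1 -> (1 - s) *: G u + s *: g u != 0) ->
  exists G' : 'rV[R]_n -> 'rV[R]_n, [/\ continuous G', forall x,
    sqnorm x <= 1 -> G' x != 0 &
    forall u, sqnorm u = 1 -> G' u = g u].
Proof.
move=> cG cg G0 Gg.
pose s (x : 'rV[R]_n) := Num.max 0 (2 * Num.sqrt (sqnorm x) - 1).
pose r (x : 'rV[R]_n) := retract (2%:R *: x).
have cs : continuous s.
  apply: cts_max (@cst_continuous _ _ _) _; apply: ctsD (@cst_continuous _ _ _).
  by apply: ctsM (@cst_continuous _ _ _) _; exact/cts_sqrt/cts_sqnorm/cts_id.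
have cr : continuous r.
  apply: cts_comp (@retract_continuous R n).
  by apply: ctsZ; [exact: cst_continuous|exact: cts_id].
have cGr := cts_comp cr cG; have cgr := cts_comp cr cg.
exists (fun x => (1 - s x) *: G (r x) + s x *: g (r x)); split.
- apply: cts_mxD; apply: ctsZ => //.
  by apply: ctsD; [exact: cst_continuous|exact: ctsN].
- move=> x x1; have [x4|/ltW x4] := leP (4 * sqnorm x) 1.
    have -> : s x = 0.
      apply: max_l; rewrite subr_le0; have := sqr_sqrtr (sqnorm_ge0 x).
      by have := sqrtr_ge0 (sqnorm x); nra.
    by rewrite subr0 scale1r scale0r addr0 G0 // retract_disc.
  apply: Gg.
    by apply: retract_sphere; rewrite sqnormZ; lra.
  rewrite le_max lexx ge_max ler01 /=; have := sqr_sqrtr (sqnorm_ge0 x).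
  by have := sqrtr_ge0 (sqnorm x); nra.
- move=> u u1; have -> : s u = 1.
    by rewrite /s u1 sqrtr1 max_r; lra.
  rewrite subrr scale0r add0r scale1r; congr g.
  rewrite /r /retract sqnormZ u1 mulr1 max_r; last lra.
  by rewrite sqrtr_sqr ger0_norm // scalerA mulVf ?scale1r // pnatr_eq0.
Qed.

Definition cmul (a b : R) (x : E) : E :=
  vec4 (a * x 0 0 - b * x 0 1) (a * x 0 1 + b * x 0 0)
       (a * x 0 2%:R - b * x 0 3%:R) (a * x 0 3%:R + b * x 0 2%:R).

Lemma cmulA a b c d x :
  cmul a b (cmul c d x) = cmul (a * c - b * d) (a * d + b * c) x.
Proof. by apply: row4P; rewrite !vec4E; ring. Qed.

Lemma cmulr0 a x : cmul a 0 x = a *: x.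
Proof. by apply: row4P; rewrite !vec4E !rowZE; ring. Qed.

Lemma sqnorm_cmul a b x : sqnorm (cmul a b x) = (a ^+ 2 + b ^+ 2) * sqnorm x.
Proof. by rewrite !sqnorm4 !vec4E; ring. Qed.

(* The real and imaginary parts of the Hermitian product, linear in y. *)
Definition hre (x y : E) : R := x 0 0 * y 0 0 + x 0 1 * y 0 1 +
  x 0 2%:R * y 0 2%:R + x 0 3%:R * y 0 3%:R.
Definition him (x y : E) : R := x 0 0 * y 0 1 - x 0 1 * y 0 0 +
  x 0 2%:R * y 0 3%:R - x 0 3%:R * y 0 2%:R.

Lemma cts_cmul (T : topologicalType) (a b : T -> R) (f : T -> E) :
  continuous a -> continuous b -> continuous f ->
  continuous (fun x => cmul (a x) (b x) (f x)).
Proof. by move=> ca cb cf; apply: cts_vec4; cts. Qed.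

(* Pushes all directions but those near (1, 0) to (-1, 0): the phase need not be
   corrected where |z1| < 1/2. *)
Definition push (y : E) : E :=
  y - vec4 (4 * Num.max 0 (3 / 4 * Num.sqrt (sqnorm y) - y 0 0)) 0 0 0.

Lemma pushE (y : E) : let t := 4 * Num.max 0 (3 / 4 * Num.sqrt (sqnorm y) - y 0
  0) in
  push y = vec4 (y 0 0 - t) (y 0 1) (y 0 2%:R) (y 0 3%:R).
Proof.
by apply: row4P; rewrite /push rowBE !vec4E ?subr0.
Qed.

Lemma push_continuous : continuous push.
Proof.
have -> : push = fun y => vec4 (y 0 0 - 4 * Num.max 0 (3 / 4 * Num.sqrt (sqnorm
  y) - y 0 0))
    (y 0 1) (y 0 2%:R) (y 0 3%:R) by apply/funext => y; rewrite pushE.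
by apply: cts_vec4; cts.
Qed.

(** Only a vector (y0, 0, 0, 0) with y0 >= 0 could be sent to 0, and such vectors are fixed by
    [push]. *)
Lemma push_neq0 (y : E) : y != 0 -> push y != 0.
Proof.
apply: contra_neq => y0; have := pushE y; rewrite y0 /=.
set t := Num.max 0 _ => /rowP e; move: (e 0) (e 1) (e 2%:R) (e 3%:R).
rewrite !vec4E !row0E => e0 e1 e2 e3.
have t0 : 0 <= t by rewrite le_max lexx.
have sy : sqnorm y = y 0 0 ^+ 2 by rewrite sqnorm4 -e1 -e2 -e3; ring.
have y00 : 0 <= y 0 0 by lra.
have te : t = 0.
  by rewrite /t max_l // sy sqrtr_sqr ger0_norm //; lra.
by apply: row4P; rewrite !row0E; lra.
Qed.

Lemma pushZ a y : 0 <= a -> push (a *: y) = a *: push y.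
Proof.
move=> a0; rewrite /push scalerBr; congr (_ - _); apply: row4P;
  rewrite !rowZE !vec4E ?mulr0 //.
rewrite sqnormZ sqrtrM ?sqr_ge0 // sqrtr_sqr ger0_norm //.
rewrite [RHS]mulrCA; congr (_ * _); rewrite maxr_pMr // mulr0; congr Num.max;
  ring.
Qed.

(** The constants 4 and 3/4 are chosen for this: the new first coordinate is 5 y0 - 3 |y|, at most -
    |y| / 2. *)
Lemma push_lt0 (y : E) : y != 0 -> y 0 0 <= Num.sqrt (sqnorm y) / 2 ->
  push y 0 0 < 0.
Proof.
move=> y0 ly; have ny0 : 0 < Num.sqrt (sqnorm y).
  by rewrite sqrtr_gt0 lt_def sqnorm_eq0 y0 sqnorm_ge0.
rewrite pushE vec4E max_r; lra.
Qed.

Lemma push_sphere_neq0 (u : E) s : sqnorm u = 1 -> 0 <= s <= 1 ->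
  (1 - s) *: push u + s *: u != 0.
Proof.
move=> u1 /andP[s0 s1]; apply: contraTneq isT => /rowP e.
move: (e 0) (e 1) (e 2%:R) (e 3%:R); rewrite pushE u1 sqrtr1 mulr1.
rewrite !rowDE !rowZE !vec4E !row0E => e0 e1 e2 e3.
move: u1; rewrite sqnorm4; set t := Num.max 0 _ in e0 *.
have t0 : 0 <= t by rewrite le_max lexx.
have -> : u 0 1 = 0 by rewrite -[RHS]e1; ring.
have -> : u 0 2%:R = 0 by rewrite -[RHS]e2; ring.
have -> : u 0 3%:R = 0 by rewrite -[RHS]e3; ring.
move=> u1; have u0 : 0 <= u 0 0.
  have -> : u 0 0 = (1 - s) * (4 * t) by rewrite -[LHS]subr0 -e0; ring.
  by rewrite !mulr_ge0 // subr_ge0.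
have u00 : u 0 0 = 1 by nra.
move: e0; rewrite /t u00 max_l; lra.
Qed.

Lemma hre_cmul a b u : hre u (cmul a b u) = a * sqnorm u.
Proof. by rewrite /hre !vec4E sqnorm4; ring. Qed.

Lemma him_cmul a b u : him u (cmul a b u) = b * sqnorm u.
Proof. by rewrite /him !vec4E sqnorm4; ring. Qed.

(* A nowhere vanishing function on the sphere, precomposed with the normalized
   [bend], extends to the whole disc and is unchanged where |z1| >= 1/2: this
   replaces the choice of a logarithm of the phase. *)
Definition bend (x : E) : E := vec4 (x 0 0) (x 0 1) (x 0 2%:R +
  (1 + x 0 2%:R ^+ 2) * Num.max 0 (1 - 4 * (x 0 0 ^+ 2 + x 0 1 ^+ 2))) (x 0
    3%:R).

(** If z1 = 0, the third coordinate becomes x + 1 + x^2, which has no real root; hence the factor 1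
    + x^2. *)
Lemma bend_neq0 (x : E) : bend x != 0.
Proof.
apply: contraTneq isT => /rowP e; move: (e 0) (e 1) (e 2%:R).
rewrite !vec4E !row0E => -> ->; rewrite expr0n /= addr0 mulr0 subr0 max_r //
  mulr1.
nra.
Qed.

Lemma bend_id (x : E) : 1 <= 4 * (x 0 0 ^+ 2 + x 0 1 ^+ 2) -> bend x = x.
Proof.
move=> x1; apply: row4P; rewrite !vec4E // max_l ?mulr0 ?addr0 //; lra.
Qed.

Lemma hre_lin (u x y : E) a b : hre u (a *: x + b *: y) = a * hre u x + b * hre
  u y.
Proof. by rewrite /hre !rowDE !rowZE; ring. Qed.

Lemma him_lin (u x y : E) a b : him u (a *: x + b *: y) = a * him u x + b * him
  u y.
Proof. by rewrite /him !rowDE !rowZE; ring. Qed.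

Theorem no_transverse_field (v : E -> E) : continuous v ->
  (forall x : E, sqnorm x <= 1 -> v x != 0) ->
  (forall u : E, sqnorm u = 1 -> hre u (v u) ^+ 2 + him u (v u) ^+ 2 != 0) ->
    False.
Proof.
move=> cv v0 uv.
pose A x := hre x (v x); pose B x := him x (v x).
have cA : continuous A by rewrite /A /hre; cts.
have cB : continuous B by rewrite /B /him; cts.
(* The target is the orthogonal projection of [v u] onto the complex line through [u]; along the
   segment the Hermitian product with [u] is constant, hence nonzero. *)
have [G2 [cG2 G20 G2E]] : exists G : E -> E, [/\ continuous G,
    forall x : E, sqnorm x <= 1 -> G x != 0 &
    forall u : E, sqnorm u = 1 -> G u = cmul (A u) (B u) u].
  apply: (homotopic_extension cv) => //; first exact: cts_cmul cA cB (@cts_id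
    _).
  move=> u s u1 _; apply: contraNneq (uv _ u1) => e.
  have := hre_lin u (v u) (cmul (A u) (B u) u) (1 - s) s.
  have := him_lin u (v u) (cmul (A u) (B u) u) (1 - s) s; rewrite e.
  have -> : him u 0 = 0 by rewrite /him !row0E; ring.
  have -> : hre u 0 = 0 by rewrite /hre !row0E; ring.
  rewrite hre_cmul him_cmul u1 -/(A u) -/(B u) => eB eA.
  have -> : A u = 0 by rewrite [RHS]eA; ring.
  have -> : B u = 0 by rewrite [RHS]eB; ring.
  by rewrite expr0n /= addr0.
pose k x := normalize (bend x).
have cbend : continuous bend by apply: cts_vec4; cts.
have ck : continuous k.
  apply: ctsZ => //; apply: ctsV; last by cts.
  by move=> x; rewrite gt_eqF // sqrtr_gt0 lt_def sqnorm_eq0 bend_neq0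
    sqnorm_ge0.
have k1 x : sqnorm (k x) = 1 by exact: sqnorm_normalize (bend_neq0 x).
(* Multiplication by the conjugate of the phase, taken at [k x]: this point is always on the sphere,
   so the factor is nonzero on the whole disc. *)
pose G3 x := cmul (A (k x)) (- B (k x)) (G2 x).
have cG3 : continuous G3.
  by apply: cts_cmul => //; [exact: cts_comp cA|apply: ctsN;
    exact: cts_comp cB].
have G30 x : sqnorm x <= 1 -> G3 x != 0.
  move=> x1; rewrite -sqnorm_eq0 sqnorm_cmul mulf_neq0 ?sqnorm_eq0 ?G20 //.
  by rewrite sqrrN uv.
have [G4 [cG4 G40 G4E]] : exists G : E -> E, [/\ continuous G,
    forall x : E, sqnorm x <= 1 -> G x != 0 &
    forall u : E, sqnorm u = 1 -> G u = push u].
  apply: (@homotopic_extension _ (push \o G3)).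
  - exact: cts_comp cG3 push_continuous.
  - exact: push_continuous.
  - by move=> x x1; apply: push_neq0; exact: G30.
  move=> u s u1 /andP[s0 s1] /=.
  have u0 : u != 0 by rewrite -sqnorm_eq0 u1 oner_eq0.
  (* Either [G3 u] is a positive multiple of [u], or z1 has at most half the norm in both [u] and
     [G3 u], and [push] sends both into the half-space of negative first coordinate. The segment
     avoids 0 in both cases. *)
  have [z1|/ltW z1] := leP 1 (4 * (u 0 0 ^+ 2 + u 0 1 ^+ 2)).
    have ku : k u = u by rewrite /k bend_id // normalize_id.
    have -> : G3 u = (A u ^+ 2 + B u ^+ 2) *: u.
      by rewrite /G3 G2E // ku cmulA -cmulr0; congr cmul; ring.
    have AB : 0 < A u ^+ 2 + B u ^+ 2 by rewrite lt_def uv // addr_ge0 ?sqr_ge0.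
    rewrite pushZ ?(ltW AB) // scalerA -scalerDl scaler_eq0 negb_or push_neq0 //
      andbT.
    rewrite gt_eqF //; have [->|s_neq0] := eqVneq s 0;
      first by rewrite subr0 mul1r addr0.
    by rewrite ltr_wpDl ?lt_def ?s_neq0 // mulr_ge0 ?subr_ge0 // ltW.
  have G3u : push (G3 u) 0 0 < 0.
    apply: push_lt0; first by rewrite G30 ?u1.
    rewrite /G3 G2E // cmulA; set p := _ - _; set q := _ + _.
    rewrite sqnorm_cmul u1 mulr1 vec4E.
    have N2 : Num.sqrt (p ^+ 2 + q ^+ 2) ^+ 2 = p ^+ 2 + q ^+ 2.
      by rewrite sqr_sqrtr // addr_ge0 ?sqr_ge0.
    have := sqrtr_ge0 (p ^+ 2 + q ^+ 2); move: N2; set N := Num.sqrt _ => N2 N0.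
    have : (p * u 0 0 - q * u 0 1) ^+ 2 <= (N / 2) ^+ 2.
      have : 0 <= (p * u 0 1 + q * u 0 0) ^+ 2 by exact: sqr_ge0.
      have : 0 <= N ^+ 2 * (1 - 4 * (u 0 0 ^+ 2 + u 0 1 ^+ 2)).
        by rewrite mulr_ge0 ?sqr_ge0 // subr_ge0.
      rewrite N2; have -> : (N / 2) ^+ 2 = (p ^+ 2 + q ^+ 2) / 4 by rewrite -N2;
        field.
      lra.
    nra.
  have pu : push u 0 0 < 0.
    apply: push_lt0 => //; rewrite u1 sqrtr1; nra.
  apply: contraTneq isT => /rowP /(_ 0); rewrite rowDE !rowZE row0E; nra.
have [G5 [cG5 G50 G5E]] : exists G : E -> E, [/\ continuous G,
    forall x : E, sqnorm x <= 1 -> G x != 0 & forall u : E, sqnorm u = 1 ->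
      G u = u].
  apply: (homotopic_extension cG4) => //; first exact: cts_id.
  by move=> u s u1 s01; rewrite G4E // push_sphere_neq0.
exact: no_retraction cG5 G50 G5E.
Qed.
End C2.

(** * Rank one projections and discrete parallel transport *)

Section ProjectionFields.
Variable R : realType.
Notation E := 'rV[R]_4.

(* The matrix [[a, b + ic], [b - ic, 1 - a]] acting on C^2 = R^4. *)
Definition proj_act (a b c : R) (w : E) : E :=
  vec4 (a * w 0 0 + b * w 0 2%:R - c * w 0 3%:R)
       (a * w 0 1 + b * w 0 3%:R + c * w 0 2%:R)
       (b * w 0 0 + c * w 0 1 + (1 - a) * w 0 2%:R)
       (b * w 0 1 - c * w 0 0 + (1 - a) * w 0 3%:R).

Lemma proj_act_idem a b c w : a * (1 - a) = b ^+ 2 + c ^+ 2 ->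
  proj_act a b c (proj_act a b c w) = proj_act a b c w.
Proof.
move=> h; have c2 : c ^+ 2 = a - a ^+ 2 - b ^+ 2 by move: h; lra.
by apply: row4P; rewrite !vec4E; ring: c2.
Qed.

(** If the first basis vector is killed, then a = b = c = 0 and the matrix projects onto the second
    basis vector. *)
Lemma proj_act_fixed a b c : a * (1 - a) = b ^+ 2 + c ^+ 2 ->
  exists2 w, w != 0 & proj_act a b c w = w.
Proof.
move=> h; have [w0|] := eqVneq (proj_act a b c (vec4 1 0 0 0)) 0; last first.
  by exists (proj_act a b c (vec4 1 0 0 0)) => //; exact: proj_act_idem.
exists (vec4 0 0 1 0).
  by apply: contraTneq isT => /rowP /(_ 2%:R); rewrite vec4E row0E; lra.
move/rowP: w0 => e; move: (e 0) (e 2%:R) (e 3%:R);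
  rewrite !vec4E !row0E => e0 e2 e3.
by apply: row4P; rewrite !vec4E; lra.
Qed.

(** If the image of [w] were 0, the difference of the two matrices would fix [w]. Each real
    coordinate of its image is a sum of three terms, so by Cauchy-Schwarz its square is at most 3/16
    times a sum of three squares. Each coordinate of [w] occurs three times in all, whence |w|^2 <=
    9/16 |w|^2. *)
Lemma proj_act_close a b c a' b' c' w : `|a - a'| < 1 / 4 ->
  `|b - b'| < 1 / 4 ->
  `|c - c'| < 1 / 4 -> proj_act a' b' c' w = w -> w != 0 ->
    proj_act a b c w != 0.
Proof.
have sq (x : R) : `|x| < 1 / 4 -> x ^+ 2 <= 1 / 16.
  by rewrite ltr_norml => /andP[? ?]; nra.
move=> /sq ha /sq hb /sq hc w'; apply: contra_neq => w0.
have cs (x y z p q r : R) : x ^+ 2 <= 1 / 16 -> y ^+ 2 <= 1 / 16 ->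
  z ^+ 2 <= 1 / 16 ->
    (x * p + y * q + z * r) ^+ 2 <= 3 / 16 * (p ^+ 2 + q ^+ 2 + r ^+ 2).
  move=> x1 y1 z1.
  have H : (x * p + y * q + z * r) ^+ 2 <=
      (x ^+ 2 + y ^+ 2 + z ^+ 2) * (p ^+ 2 + q ^+ 2 + r ^+ 2).
    have := sqr_ge0 (x * q - y * p); have := sqr_ge0 (x * r - z * p).
    by have := sqr_ge0 (y * r - z * q); lra.
  apply: le_trans H _; rewrite ler_wpM2r ?addr_ge0 ?sqr_ge0 //; lra.
move: w0 w' => /rowP e /rowP e'.
move: (e 0) (e 1) (e 2%:R) (e 3%:R) (e' 0) (e' 1) (e' 2%:R) (e' 3%:R).
rewrite !vec4E !row0E => e0 e1 e2 e3 f0 f1 f2 f3.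
have hb' : (- (b - b')) ^+ 2 <= 1 / 16 by rewrite sqrrN.
have hc' : (- (c - c')) ^+ 2 <= 1 / 16 by rewrite sqrrN.
have ha' : (- (a - a')) ^+ 2 <= 1 / 16 by rewrite sqrrN.
have := cs _ _ _ (w 0 0) (w 0 2%:R) (w 0 3%:R) ha' hb' hc.
have -> : - (a - a') * w 0 0 + - (b - b') * w 0 2%:R + (c - c') * w 0 3%:R = w 0
  0.
  by rewrite -[RHS]f0 -[LHS]addr0 -e0; ring.
have := cs _ _ _ (w 0 1) (w 0 3%:R) (w 0 2%:R) ha' hb' hc'.
have -> : - (a - a') * w 0 1 + - (b - b') * w 0 3%:R + - (c - c') * w 0 2%:R = w
  0 1.
  by rewrite -[RHS]f1 -[LHS]addr0 -e1; ring.
have := cs _ _ _ (w 0 0) (w 0 1) (w 0 2%:R) hb' hc' ha.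
have -> : - (b - b') * w 0 0 + - (c - c') * w 0 1 + (a - a') * w 0 2%:R = w 0
  2%:R.
  by rewrite -[RHS]f2 -[LHS]addr0 -e2; ring.
have := cs _ _ _ (w 0 1) (w 0 0) (w 0 3%:R) hb' hc ha.
have -> : - (b - b') * w 0 1 + (c - c') * w 0 0 + (a - a') * w 0 3%:R = w 0
  3%:R.
  by rewrite -[RHS]f3 -[LHS]addr0 -e3; ring.
move=> *; apply/eqP; rewrite -sqnorm_eq0 eq_le sqnorm_ge0 andbT sqnorm4.
have := sqr_ge0 (w 0 0); have := sqr_ge0 (w 0 1); have := sqr_ge0 (w 0 2%:R).
by have := sqr_ge0 (w 0 3%:R); lra.
Qed.

(** The matrix is self-adjoint of trace 1, so the eigenvalue 1 on [v] leaves the eigenvalue 0 for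
    the orthogonal line. *)
Lemma proj_act_hermitian a b c (u v : E) : proj_act a b c v = v -> v != 0 ->
  hre u v ^+ 2 + him u v ^+ 2 = 0 -> proj_act a b c u = 0.
Proof.
move=> /rowP e v0 uv.
have n0 : sqnorm v != 0 by rewrite sqnorm_eq0.
have hu : hre u v = 0 by apply/eqP; rewrite -sqrf_eq0;
  have := sqr_ge0 (hre u v); have := sqr_ge0 (him u v); rewrite eq_le; lra.
have iu : him u v = 0 by apply/eqP; rewrite -sqrf_eq0;
  have := sqr_ge0 (hre u v); have := sqr_ge0 (him u v); rewrite eq_le; lra.
move: hu iu n0 (e 0) (e 1) (e 2%:R) (e 3%:R); rewrite !vec4E /hre /him sqnorm4.
move=> hu iu n0 e0 e1 e2 e3.
pose n := v 0 0 ^+ 2 + v 0 1 ^+ 2 + v 0 2%:R ^+ 2 + v 0 3%:R ^+ 2.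
have sub0 (x y : R) : x = y -> x - y = 0 by move=> ->; rewrite subrr.
move: (sub0 _ _ e0) (sub0 _ _ e1) (sub0 _ _ e2) (sub0 _ _ e3).
set E0 := _ - _; set E1 := _ - _; set E2 := _ - _; set E3 := _ - _.
move=> z0 z1 z2 z3.
(* [n] times the matrix is v v^*. *)
have na : n * a = v 0 0 ^+ 2 + v 0 1 ^+ 2.
  transitivity (v 0 0 ^+ 2 + v 0 1 ^+ 2 + (v 0 0 * E0 + v 0 1 * E1 - v 0 2%:R *
    E2 - v 0 3%:R * E3)).
    by rewrite /E0 /E1 /E2 /E3 /n; ring.
  by rewrite z0 z1 z2 z3; ring.
have nb : n * b = v 0 0 * v 0 2%:R + v 0 1 * v 0 3%:R.
  transitivity (v 0 0 * v 0 2%:R + v 0 1 * v 0 3%:R + (v 0 2%:R * E0 + v 0 3%:R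
    * E1 + v 0 0 * E2 + v 0 1 * E3)).
    by rewrite /E0 /E1 /E2 /E3 /n; ring.
  by rewrite z0 z1 z2 z3; ring.
have nc : n * c = v 0 1 * v 0 2%:R - v 0 0 * v 0 3%:R.
  transitivity (v 0 1 * v 0 2%:R - v 0 0 * v 0 3%:R + (v 0 2%:R * E1 - v 0 3%:R
    * E0 + v 0 1 * E2 - v 0 0 * E3)).
    by rewrite /E0 /E1 /E2 /E3 /n; ring.
  by rewrite z0 z1 z2 z3; ring.
have main (x p q : R) : n * x = p * hre u v + q * him u v -> x = 0.
  by rewrite /hre hu /him iu !mulr0 addr0 => /eqP;
    rewrite mulf_eq0 (negPf n0) => /eqP.
apply: row4P; rewrite vec4E row0E.
- apply: (main _ (v 0 0) (v 0 1)); rewrite mulrBr mulrDr !mulrA na nb nc /hre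
    /him; ring.
- apply: (main _ (v 0 1) (- v 0 0)); rewrite !mulrDr !mulrA na nb nc /hre /him;
    ring.
- apply: (main _ (v 0 2%:R) (v 0 3%:R)); rewrite !mulrDr !mulrA mulrBr mulr1 na
    nb nc /hre /him /n; ring.
- apply: (main _ (v 0 3%:R) (- v 0 2%:R)); rewrite mulrDr mulrBr !mulrA mulrBr
    mulr1 na nb nc /hre /him /n; ring.
Qed.

Theorem no_transverse_projection (a b c : E -> R) :
  continuous a -> continuous b -> continuous c ->
  (forall x, a x * (1 - a x) = b x ^+ 2 + c x ^+ 2) ->
  (forall u, sqnorm u = 1 -> proj_act (a u) (b u) (c u) u != 0) -> False.
Proof.
move=> ca cb cc h hu.
pose P x := proj_act (a x) (b x) (c x).
have unif (f : E -> R) : continuous f -> exists2 d : R, 0 < d &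
    forall x y : E, sqnorm x <= 1 -> (forall j, `|x 0 j - y 0 j| < d) ->
      `|f x - f y| < 1 / 4.
  by move=> cf; apply: (unif_continuous_on_compact (@compact_disc R 4 1) cf);
    lra.
have [da da0 Pa] := unif _ ca; have [db db0 Pb] := unif _ cb;
  have [dc dc0 Pc] := unif _ cc.
pose d := Num.min da (Num.min db dc).
have d0 : 0 < d by rewrite !lt_min da0 db0.
pose N := (Num.bound d^-1).+1.
have N0 : 0 < N%:R :> R by rewrite ltr0n.
have Nd : N%:R^-1 < d.
  rewrite invf_plt ?posrE // /N -natr1; apply: lt_le_trans (archi_boundP _) _.
    by rewrite invr_ge0 ltW.
  by rewrite lerDl.
have Pclose (x y w : E) : sqnorm x <= 1 -> (forall j, `|x 0 j - y 0 j| < d) ->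
    P y w = w -> w != 0 -> P x w != 0.
  move=> x1 xy; apply: proj_act_close.
  - by apply: Pa => // j; apply: lt_le_trans (xy j) _; rewrite ge_min lexx.
  - by apply: Pb => // j; apply: lt_le_trans (xy j) _;
      rewrite !ge_min lexx orbT.
  - by apply: Pc => // j; apply: lt_le_trans (xy j) _;
      rewrite !ge_min lexx !orbT.
have [w w0 Pw] := proj_act_fixed (h 0).
pose at_ k (x : E) := (k%:R / N%:R) *: x.
(* The vector [w] is projected successively onto the lines over N points of the ray to [x]. As N
   does not depend on [x], every [v k] is continuous; [proj_act_close] keeps it nonzero. *)
pose v := fix v k (x : E) := if k is k'.+1 then P (at_ k x) (v k' x) else w.
have cv k : continuous (v k).
  elim: k => [|k ih] /=; first exact: cst_continuous.
  have cat : continuous (at_ k.+1) by apply: ctsZ;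
    [exact: cst_continuous|exact: cts_id].
  by rewrite /P /proj_act; have := cts_comp cat ca; have := cts_comp cat cb;
    have := cts_comp cat cc => *;
  apply: cts_vec4; cts.
have at_disc k (x : E) : (k <= N)%N -> sqnorm x <= 1 -> sqnorm (at_ k x) <= 1.
  move=> kN x1; rewrite sqnormZ mulr_ile1 ?sqr_ge0 ?sqnorm_ge0 //.
  by rewrite expr_le1 // ?divr_ge0 // ler_pdivrMr // mul1r ler_nat.
have vP k (x : E) : (k <= N)%N -> sqnorm x <= 1 ->
    v k x != 0 /\ P (at_ k x) (v k x) = v k x.
  move=> kN x1; elim: k kN => [|k ih] kN; first by rewrite /at_ mul0r scale0r.
  have [vk0 Pk] := ih (ltnW kN); split; last exact: proj_act_idem.
  apply: Pclose Pk vk0; first exact: at_disc.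
  move=> j; rewrite !rowZE -mulrBl -mulrBl -natrB // subSnn mul1r normrM.
  rewrite gtr0_norm ?invr_gt0 //; apply: le_lt_trans Nd.
  rewrite ler_piMr ?invr_ge0 ?(ltW N0) //.
  by have := le_trans (coord_le_sqnorm x j) x1; rewrite ler_norml; nra.
have at_N x : at_ N x = x by rewrite /at_ divff ?scale1r // gt_eqF.
apply: (no_transverse_field (cv N)) => [x x1|u u1];
  first by case: (vP N x (leqnn _) x1).
have [|vN0] := vP N u (leqnn _); first by rewrite u1.
rewrite at_N => PN.
apply: contraNneq (hu _ u1) => uv; apply/eqP.
exact: proj_act_hermitian PN vN0 uv.
Qed.
End ProjectionFields.

(** * Complex 2 x 2 matrices *)

Section ComplexTopology.
Variable R : realType.
Implicit Types (z : R[i]).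
Notation normc := ComplexField.Normc.normc.
Notation Re := (@complex.Re R).
Notation Im := (@complex.Im R).

Lemma cts_Re (T : topologicalType) (f : T -> R[i]) :
  continuous f -> continuous (fun x => Re (f x)).
Proof.
move=> cf; apply: (cts_comp cf) => z A /nbhs_ballP[e /= e0 eA].
apply/nbhs_ballP; exists (e%:C); first by rewrite /= ltcR.
move=> z'; rewrite -ball_normE /= => zz'; apply: eA.
have := le_lt_trans (normc_ge_Re _) zz'; rewrite ltcR.
by rewrite -ball_normE /= raddfB.
Qed.

Lemma cts_Im (T : topologicalType) (f : T -> R[i]) :
  continuous f -> continuous (fun x => Im (f x)).
Proof.
move=> cf; apply: (cts_comp cf) => z A /nbhs_ballP[e /= e0 eA].
apply/nbhs_ballP; exists (e%:C); first by rewrite /= ltcR.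
move=> z'; rewrite -ball_normE /= => zz'; apply: eA.
have : `|Im (z - z')| < e.
  rewrite -ltcR; apply: le_lt_trans zz'; rewrite normc_def lecR -sqrtr_sqr.
  by rewrite ler_wsqrtr // lerDr sqr_ge0.
by rewrite -ball_normE /= raddfB.
Qed.

Lemma cts_complex (T : topologicalType) (f g : T -> R) :
  continuous f -> continuous g -> continuous (fun x => (f x +i* g x)%C : R[i]).
Proof.
move=> cf cg x A /nbhs_ballP[e /= e0 eA].
have /andP[/= /eqP ei0 er0] : (Im e == 0) && (0 < Re e) by have := e0;
  rewrite ltcE.
case: e ei0 er0 eA {e0} => e ei /= -> e0 eA.
have e2 : 0 < e / 2 by rewrite divr_gt0.
have /cvgrPdist_lt /(_ _ e2) fe := cf x; have /cvgrPdist_lt /(_ _ e2) ge :=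
  cg x.
suff : nbhs x (fun y => A (f y +i* g y)%C) by [].
apply: filterS (filterI fe ge) => y [/= fy gy]; apply: eA.
rewrite -ball_normE /= normc_def ltcR /=.
rewrite -[ltRHS](@ger0_norm _ e) ?ltW // -sqrtr_sqr ltr_sqrt ?exprn_gt0 //.
move: fy gy; rewrite !ltr_norml => /andP[? ?] /andP[? ?]; nra.
Qed.

Lemma normcE z : normc z = Num.sqrt (Re z ^+ 2 + Im z ^+ 2).
Proof. by case: z. Qed.

Lemma cts_normc (T : topologicalType) (f : T -> R[i]) :
  continuous f -> continuous (fun x => normc (f x)).
Proof.
move=> cf; under eq_fun do rewrite normcE; apply: cts_sqrt; apply: ctsD.
  by apply: ctsX; exact: cts_Re.
by apply: ctsX; exact: cts_Im.
Qed.

Lemma cts_centry (T : topologicalType) m n (f : T -> 'M[R[i]]_(m, n)) i j :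
  continuous f -> continuous (fun x => f x i j).
Proof.
move=> cf; apply: (cts_comp (g := fun A : 'M[R[i]]_(m, n) => A i j) cf).
exact: (@coord_continuous R[i]).
Qed.
End ComplexTopology.

Section TwoByTwo.
Variable R : realType.
Notation normc := ComplexField.Normc.normc.
Notation Re := (@complex.Re R).
Notation Im := (@complex.Im R).
Notation E := 'rV[R]_4.
Implicit Types (M P Q : 'M[R[i]]_2) (v : 'cV[R[i]]_2).

Lemma sum_ord2 (V : nmodType) (F : 'I_2 -> V) : \sum_i F i = F 0 + F 1.
Proof. by rewrite !big_ord_recl big_ord0 addr0; congr (F _ + F _);
  exact: val_inj. Qed.

Lemma ord2_ind (T : 'I_2 -> Prop) : T 0 -> T 1 -> forall i, T i.
Proof.
move=> T0 T1 [[|[|//]] lti].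
- by rewrite (_ : Ordinal lti = 0) //; exact: val_inj.
- by rewrite (_ : Ordinal lti = 1) //; exact: val_inj.
Qed.

Lemma mulmx2E m n (M : 'M[R[i]]_(m, 2)) (N : 'M[R[i]]_(2, n)) i j :
  (M *m N) i j = M i 0 * N 0 j + M i 1 * N 1 j.
Proof. by rewrite mxE sum_ord2. Qed.

Definition vecC (w : E) : 'cV[R[i]]_2 :=
  \col_i if i == 0 then (w 0 0 +i* w 0 1)%C else (w 0 2%:R +i* w 0 3%:R)%C.

Lemma cV_normE v : cV_norm v = Num.sqrt (normc (v 0 0) ^+ 2 + normc (v 1 0) ^+
  2).
Proof. by rewrite /cV_norm sum_ord2. Qed.

Lemma cV_norm_vecC w : cV_norm (vecC w) = Num.sqrt (sqnorm w).
Proof.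
rewrite cV_normE !mxE /= !sqr_sqrtr ?addr_ge0 ?sqr_ge0 // sqnorm4.
by rewrite !addrA.
Qed.

Lemma vecCB x y : vecC (x - y) = vecC x - vecC y.
Proof. by apply/colP; apply: ord2_ind; rewrite !mxE. Qed.

Lemma vecCZ (a : R) x : vecC (a *: x) = a%:C *: vecC x.
Proof.
by apply/colP; apply: ord2_ind; rewrite !mxE /=; apply/eqP;
  rewrite eq_complex /= !mul0r subr0 addr0 !eqxx.
Qed.

(** A crude continuous bound of the operator norm: it bounds the sets whose suprema define the
    norms, without which [sup] would say nothing. *)
Definition entry_sum M : R := \sum_i \sum_j normc (M i j).

Lemma normc_ge0 (z : R[i]) : 0 <= normc z.
Proof. by rewrite normcE sqrtr_ge0. Qed.

Lemma cV_norm_mul M v : cV_norm v <= 1 -> cV_norm (M *m v) <= entry_sum M.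
Proof.
move=> v1; have vj j : normc (v j 0) <= 1.
  apply: le_trans v1; rewrite cV_normE -[leLHS](ger0_norm (normc_ge0 _))
    -sqrtr_sqr.
  by rewrite ler_wsqrtr //; elim/ord2_ind: j; rewrite ?lerDl ?lerDr sqr_ge0.
have rowle i : normc ((M *m v) i 0) <= \sum_j normc (M i j).
  rewrite mulmx2E sum_ord2 (le_trans (le_normcD _ _)) //.
  by rewrite !ComplexField.Normc.normcM lerD // ler_piMr ?normc_ge0.
rewrite cV_normE /entry_sum sum_ord2.
have x0 := normc_ge0 ((M *m v) 0 0); have y0 := normc_ge0 ((M *m v) 1 0).
apply: le_trans (lerD (rowle 0) (rowle 1)).
rewrite -[leRHS]ger0_norm ?addr_ge0 // -sqrtr_sqr ler_wsqrtr //.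
by rewrite sqrrD -addrA (addrCA (_ ^+ 2)) lerDr mulrn_wge0 // mulr_ge0.
Qed.

Lemma op_norm_le M : op_norm M <= entry_sum M.
Proof.
apply: ge_sup => [|_ [v /= v1 <-]]; last exact: cV_norm_mul.
exists (cV_norm (M *m 0)), 0 => //=.
by rewrite cV_normE !mxE ComplexField.Normc.normc0 expr0n /= addr0 sqrtr0 ler01.
Qed.

Lemma le_op_norm M v : cV_norm v <= 1 -> cV_norm (M *m v) <= op_norm M.
Proof.
move=> v1; apply: ub_le_sup; last by exists v.
by exists (entry_sum M) => _ [w /= w1 <-]; exact: cV_norm_mul.
Qed.

Lemma le_CM2_norm (Y : topologicalType) (f : Y -> 'M[R[i]]_2) :
  compact [set: Y] -> continuous f -> forall y, op_norm (f y) <= CM2_norm f.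
Proof.
move=> cY cf y; apply: ub_le_sup; last by exists y.
have ce : continuous (fun y => entry_sum (f y)).
  by do 2 (apply: continuous_sum => ?); apply: cts_normc; exact: cts_centry.
have [c _ fc] : exists2 c, c \in [set: Y] & forall t, t \in [set: Y] ->
    entry_sum (f t) <= entry_sum (f c).
  apply: compact_EVT_max => //; first by exists y.
  exact: continuous_subspaceT.
exists (entry_sum (f c)) => _ [t _ <-].
by apply: le_trans (op_norm_le _) (fc _ _); rewrite inE.
Qed.

(** What has to be shown is trace 1. Otherwise the off-diagonal entries of P^2 = P force b = c = 0,
    the diagonal entries are equal and 0 or 1, and P is 0 or the identity, of rank 0 or 2. *)
Lemma rank_one_projectionE P : P \is hermsymmx -> P *m P = P -> \rank P = 1%N ->
  let a := Re (P 0 0) in let b := Re (P 0 1) in let c := Im (P 0 1) in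
  a * (1 - a) = b ^+ 2 + c ^+ 2 /\
  forall w, P *m vecC w = vecC (proj_act a b c w).
Proof.
move=> /is_hermitianmxP Ph PP rP a b c.
have hP i j : P i j = (P j i)^*%C.
  by rewrite {1}Ph !mxE expr0 mul1r.
have P00 : P 0 0 = (a +i* 0)%C.
  have := hP 0 0; rewrite /a; case: (P 0 0) => x y [/= y0].
  by congr (_ +i* _)%C; lra.
have P01 : P 0 1 = (b +i* c)%C by rewrite /b /c; case: (P 0 1).
have P10 : P 1 0 = (b -i* c)%C by rewrite hP P01.
pose d := Re (P 1 1).
have P11 : P 1 1 = (d +i* 0)%C.
  have := hP 1 1; rewrite /d; case: (P 1 1) => x y [/= y0].
  by congr (_ +i* _)%C; lra.
have e00 : a ^+ 2 + b ^+ 2 + c ^+ 2 = a.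
  by have := congr1 (fun M => Re (M 0 0)) PP; rewrite mulmx2E P00 P01 P10 /=;
    lra.
have e11 : b ^+ 2 + c ^+ 2 + d ^+ 2 = d.
  by have := congr1 (fun M => Re (M 1 1)) PP; rewrite mulmx2E P11 P01 P10 /=;
    lra.
have eb : b * (a + d - 1) = 0.
  by have := congr1 (fun M => Re (M 0 1)) PP; rewrite mulmx2E P00 P01 P11 /=;
    lra.
have ec : c * (a + d - 1) = 0.
  by have := congr1 (fun M => Im (M 0 1)) PP; rewrite mulmx2E P00 P01 P11 /=;
    lra.
have ad : d = 1 - a.
  apply: contra_eq rP => nad; have nad' : a + d - 1 != 0.
    by apply: contraNneq nad => ad0; apply/eqP; lra.
  have b0 : b = 0 by apply/eqP; move/eqP: eb; rewrite mulf_eq0 (negPf nad')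
    orbF.
  have c0 : c = 0 by apply/eqP; move/eqP: ec; rewrite mulf_eq0 (negPf nad')
    orbF.
  have /orP[/eqP a0|/eqP a1] : (a == 0) || (a - 1 == 0).
  - by rewrite -mulf_eq0; apply/eqP; move: e00; rewrite b0 c0; lra.
  - have d0 : d = 0.
      have : d * (d - 1) = 0 by move: e11; rewrite b0 c0; lra.
      by move/eqP; rewrite mulf_eq0 => /orP[/eqP//|/eqP d1]; case/eqP: nad; lra.
    rewrite (_ : P = 0) ?mxrank0 //; apply/matrixP; apply: ord2_ind;
      apply: ord2_ind;
    by rewrite ?P00 ?P01 ?P10 ?P11 mxE ?a0 ?b0 ?c0 ?d0 ?oppr0.
  - have d1 : d = 1.
      have : d * (d - 1) = 0 by move: e11; rewrite b0 c0; lra.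
      by move/eqP; rewrite mulf_eq0 => /orP[/eqP d0|/eqP d1]; [case/eqP: nad;
        lra|lra].
    have {}a1 : a = 1 by lra.
    rewrite (_ : P = 1%:M) ?mxrank1 //; apply/matrixP; apply: ord2_ind;
      apply: ord2_ind;
    by rewrite ?P00 ?P01 ?P10 ?P11 mxE ?a1 ?b0 ?c0 ?d1 ?oppr0.
split; first by lra.
move=> w; apply/colP; apply: ord2_ind; rewrite mulmx2E ?P00 ?P01 ?P10 ?P11 !mxE
  /=;
  apply/eqP; rewrite eq_complex /=; apply/andP; split; apply/eqP; rewrite ?ad;
    ring.
Qed.
End TwoByTwo.

(** * The Hopf element *)

Section Hopf.
Variable R : realType.
Notation normc := ComplexField.Normc.normc.
Notation Re := (@complex.Re R).
Notation Im := (@complex.Im R).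
Notation E := 'rV[R]_4.

Lemma sphere_same_sign_line n (d : 'rV[R]_n ->
  R) (u v : 'rV[R]_n) : continuous d ->
  (forall u, sqnorm u = 1 -> d u != 0) -> sqnorm u = 1 -> sqnorm v = 1 ->
  (forall t : R, (1 - t) *: u + t *: v != 0) -> 0 < d u -> 0 < d v.
Proof.
move=> cd d0 u1 v1 uv du.
pose f t := d (normalize ((1 - t) *: u + t *: v)).
have cw : continuous (fun t : R => (1 - t) *: u + t *: v).
  apply: cts_mxD; apply: ctsZ; try exact: cst_continuous; last exact: cts_id.
  by apply: ctsD; [exact: cst_continuous|apply: ctsN; exact: cts_id].
have cf : continuous f.
  apply: (@cts_comp R 'rV[R]_n R _ d) cd; apply: ctsZ => //; apply: ctsV.
    by move=> t; rewrite gt_eqF // sqrtr_gt0 lt_def sqnorm_eq0 uv sqnorm_ge0.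
  by apply: cts_sqrt; exact: cts_sqnorm.
have f0 : f 0 = d u by rewrite /f subr0 scale1r scale0r addr0 normalize_id.
have f1 : f 1 = d v by rewrite /f subrr scale0r scale1r add0r normalize_id.
rewrite ltNge; apply/negP => dv.
have [|t _ ft] := @IVT R f 0 1 0 ler01 (continuous_subspaceT cf).
  by rewrite f0 f1 le_max ge_min dv (ltW du) orbT.
by have := d0 _ (sqnorm_normalize (uv t)); rewrite -/(f t) ft eqxx.
Qed.

Lemma sphere_same_sign (d : E -> R) (u v : E) : continuous d ->
  (forall u, sqnorm u = 1 -> d u != 0) -> sqnorm u = 1 -> sqnorm v = 1 ->
  0 < d u -> 0 < d v.
Proof.
move=> cd d0.
have line (x y : E) : sqnorm x = 1 -> sqnorm y = 1 -> y != x -> y != - x ->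
  0 < d x -> 0 < d y.
  move=> x1 y1 yx ynx; apply: sphere_same_sign_line => // t; apply/eqP => e.
  have e' : t *: y = - ((1 - t) *: x) by apply/eqP; rewrite -addr_eq0 addrC e.
  have := congr1 (@sqnorm R 4) e'; rewrite -scaleNr !sqnormZ x1 y1 => t2.
  (* The norms give t^2 = (1 - t)^2: a chord meets 0 only at its midpoint, hence only between
     antipodes. *)
  have t12 : t = 1 / 2 by move: t2; lra.
  case/eqP: ynx; move: e'; rewrite t12.
  have -> : 1 - 1 / 2 = 1 / 2 :> R by lra.
  by rewrite -scalerN => /scalerI; apply; lra.
move=> u1 v1 du; have [->//|vu] := eqVneq v u.
have [->|] := eqVneq v (- u); last by move=> vnu; exact: line du.
(* Antipodes are joined through i u, which is orthogonal to u in R^4. *)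
pose w := cmul 0 1 u.
have w1 : sqnorm w = 1 by rewrite sqnorm_cmul u1 expr0n /= add0r expr1n mulr1.
have hw : hre u w = 0 by rewrite hre_cmul mul0r.
have hu : hre u u = 1 by rewrite -u1 sqnorm4 /hre; ring.
have hnu : hre u (- u) = -1.
  by rewrite -scaleN1r -[X in hre _ X]addr0 -(scale0r u) hre_lin hu; ring.
have wu : w != u by apply: contra_eqN hw => /eqP ->; rewrite hu oner_eq0.
have wnu : w != - u by apply: contra_eqN hw => /eqP ->;
  rewrite hnu oppr_eq0 oner_eq0.
apply: (line w) => //.
- by rewrite -scaleN1r sqnormZ u1; ring.
- by rewrite eq_sym.
- by rewrite eqr_opp eq_sym.
- exact: (line u).
Qed.

(** On S^3 this is the Hopf map, S^2 being the set of traceless self-adjoint unitaries; the entry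
    above the diagonal is 2 z1 times the conjugate of z2. *)
Definition hopf (w : E) : 'M[R[i]]_2 := \matrix_(i, j)
  let n := w 0 0 ^+ 2 + w 0 1 ^+ 2 - w 0 2%:R ^+ 2 - w 0 3%:R ^+ 2 in
  let x := 2 * (w 0 0 * w 0 2%:R + w 0 1 * w 0 3%:R) in
  let y := 2 * (w 0 1 * w 0 2%:R - w 0 0 * w 0 3%:R) in
  if i == 0 then if j == 0 then n%:C else (x +i* y)%C
  else if j == 0 then (x -i* y)%C else (- n)%:C.

Lemma hopfE (w : E) :
  (hopf w 0 0 = ((w 0 0 ^+ 2 + w 0 1 ^+ 2 - w 0 2%:R ^+ 2 - w 0 3%:R ^+ 2) +i*
    0)%C) *
  (hopf w 0 1 = ((2 * (w 0 0 * w 0 2%:R + w 0 1 * w 0 3%:R)) +i*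
                (2 * (w 0 1 * w 0 2%:R - w 0 0 * w 0 3%:R)))%C) *
  (hopf w 1 0 = ((2 * (w 0 0 * w 0 2%:R + w 0 1 * w 0 3%:R)) +i*
                (- (2 * (w 0 1 * w 0 2%:R - w 0 0 * w 0 3%:R))))%C) *
  (hopf w 1 1 = ((- (w 0 0 ^+ 2 + w 0 1 ^+ 2 - w 0 2%:R ^+ 2 - w 0 3%:R ^+ 2))
    +i* 0)%C).
Proof. by rewrite !mxE. Qed.

(** In complex terms, the pair of - conj z2 and conj z1, which spans the orthogonal line. *)
Definition perp (w : E) : E := vec4 (- w 0 2%:R) (w 0 3%:R) (w 0 0) (- w 0 1).

Lemma sqnorm_perp w : sqnorm (perp w) = sqnorm w.
Proof. by rewrite !sqnorm4 !vec4E; ring. Qed.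

Lemma hopf_vecC w : hopf w *m vecC w = vecC (sqnorm w *: w).
Proof.
apply/colP; apply: ord2_ind; rewrite mulmx2E !mxE /= sqnorm4; apply/eqP;
by rewrite eq_complex /=; apply/andP; split; apply/eqP; ring.
Qed.

Lemma hopf_perp w : hopf w *m vecC (perp w) = vecC (- sqnorm w *: perp w).
Proof.
apply/colP; apply: ord2_ind; rewrite mulmx2E !mxE /= sqnorm4; apply/eqP;
by rewrite eq_complex /=; apply/andP; split; apply/eqP; ring.
Qed.

Lemma hre_le (u w : E) : sqnorm u = 1 -> Num.sqrt (sqnorm w) < 1 ->
  - 1 < hre u w < 1.
Proof.
move=> u1; rewrite -[ltRHS]sqrtr1 ltr_sqrt // => w1.
have cs : hre u w ^+ 2 <= sqnorm u * sqnorm w.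
  rewrite !sqnorm4 /hre.
  have := sqr_ge0 (u 0 0 * w 0 1 - u 0 1 * w 0 0).
  have := sqr_ge0 (u 0 0 * w 0 2%:R - u 0 2%:R * w 0 0).
  have := sqr_ge0 (u 0 0 * w 0 3%:R - u 0 3%:R * w 0 0).
  have := sqr_ge0 (u 0 1 * w 0 2%:R - u 0 2%:R * w 0 1).
  have := sqr_ge0 (u 0 1 * w 0 3%:R - u 0 3%:R * w 0 1).
  have := sqr_ge0 (u 0 2%:R * w 0 3%:R - u 0 3%:R * w 0 2%:R).
  lra.
by rewrite u1 mul1r in cs; apply/andP; split; nra.
Qed.

Lemma vecC_inj : injective (@vecC R).
Proof.
move=> x y /colP e; move: (e 0) (e 1); rewrite !mxE /= => -[? ?] [? ?].
exact: row4P.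
Qed.

(** The difference of the two diagonal entries of the product is a + a' - 1. With a' = 1 - a, the
    remaining relations say that (b + b')^2 + (c + c')^2 = 0. *)
Lemma orthogonal_proj_act (a b c a' b' c' : R) :
  a * (1 - a) = b ^+ 2 + c ^+ 2 ->
  a' * (1 - a') = b' ^+ 2 + c' ^+ 2 ->
  (forall w, proj_act a b c (proj_act a' b' c' w) = 0) ->
  [/\ a' = 1 - a, b' = - b & c' = - c].
Proof.
move=> h h' e.
have := congr1 (fun w : E => w 0 0) (e (vec4 1 0 0 0)).
have := congr1 (fun w : E => w 0 2%:R) (e (vec4 0 0 1 0)).
rewrite !vec4E !row0E => e2 e0.
have a1 : a' = 1 - a by move: e0 e2; lra.
have : (b + b') ^+ 2 + (c + c') ^+ 2 = 0 by move: e0 h h'; rewrite a1; lra.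
move=> s; have := sqr_ge0 (b + b'); have := sqr_ge0 (c + c') => s1 s2.
have /eqP : (b + b') ^+ 2 = 0 by lra.
have /eqP : (c + c') ^+ 2 = 0 by lra.
by rewrite !sqrf_eq0 !addr_eq0 => /eqP -> /eqP ->; rewrite !opprK.
Qed.

(* Test the bound on u and on [perp u]: with q = <u, P1 u>, they give
   a2 + (a1 - a2) q > 0 and a2 + (a1 - a2) (1 - q) < 0. *)
Lemma hopf_gap (a b c a1 a2 : R) (P1 P2 : 'M[R[i]]_2) (u : E) : sqnorm u = 1 ->
  (forall w, P1 *m vecC w = vecC (proj_act a b c w)) ->
  (forall w, P2 *m vecC w = vecC (proj_act (1 - a) (- b) (- c) w)) ->
  op_norm (hopf u - (a1%:C *: P1 + a2%:C *: P2)) < 1 ->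
  0 < (a1 - a2) * (2 * hre u (proj_act a b c u) - 1).
Proof.
move=> u1 E1 E2; set M := _ - _ => M1.
have ME w : M *m vecC w = hopf u *m vecC w - vecC (a2 *: w + (a1 - a2) *:
  proj_act a b c w).
  rewrite /M mulmxBl mulmxDl -!scalemxAl E1 E2 -!vecCZ; congr (_ - _).
  apply/colP; apply: ord2_ind; rewrite !mxE /=; apply/eqP;
    rewrite eq_complex /=;
    apply/andP; split; apply/eqP; ring.
have M1' w : sqnorm w = 1 -> cV_norm (M *m vecC w) < 1.
  by move=> w1; apply: le_lt_trans (le_op_norm _ _) M1;
    rewrite cV_norm_vecC w1 sqrtr1.
have := M1' _ u1; rewrite ME hopf_vecC u1 scale1r -vecCB cV_norm_vecC.
move=> /(hre_le u1)/andP[_ hu].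
have u1' : sqnorm (perp u) = 1 by rewrite sqnorm_perp.
have := M1' _ u1'; rewrite ME hopf_perp u1 -vecCB cV_norm_vecC.
move=> /(hre_le u1')/andP[hp _].
set q := hre u (proj_act a b c u).
have {}hu : 0 < a2 + (a1 - a2) * q.
  move: hu; have -> : hre u (u - (a2 *: u + (a1 - a2) *: proj_act a b c u)) =
      sqnorm u - a2 * sqnorm u - (a1 - a2) * q.
    by rewrite /q sqnorm4 /hre !rowBE !rowDE !rowZE; ring.
  by rewrite u1; lra.
have {}hp : a2 + (a1 - a2) * (1 - q) < 0.
  move: hp; have -> : hre (perp u) (- (1) *: perp u -
      (a2 *: perp u + (a1 - a2) *: proj_act a b c (perp u))) =
      - sqnorm u - a2 * sqnorm u - (a1 - a2) * (sqnorm u - q).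
    by rewrite /q sqnorm4 /hre !rowBE !rowDE !rowZE !vec4E; ring.
  by rewrite u1; lra.
lra.
Qed.

Lemma cts_mxC (T : topologicalType) m n (f : T -> 'M[R[i]]_(m, n)) :
  (forall i j, continuous (fun x => Re (f x i j))) ->
  (forall i j, continuous (fun x => Im (f x i j))) -> continuous f.
Proof.
move=> cr ci; apply: continuous_mx => i j.
have -> : (fun x => f x i j) = (fun x => Re (f x i j) +i* Im (f x i j))%C.
  by apply/funext => x; case: (f x i j).
exact: cts_complex.
Qed.

Theorem hopf_not_diagonalizable (Y : topologicalType) (g : E ->
  Y) (b : CM2 R Y) :
  compact [set: Y] -> continuous g ->
  (forall u, sqnorm u = 1 -> b (g u) = hopf u) -> ~ approx_diagonalizable b.
Proof.
move=> cY cg bu /(_ 1 ltr01)[a1 [a2 [p1 [p2 [[[h1 i1] r1] [[h2 i2] r2] o]]]]].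
set f := fun y => _ => f1.
have cf : continuous f.
  have cb : continuous b by exact: cts_fun.
  have cp1 : continuous p1 by exact: cts_fun.
  have cp2 : continuous p2 by exact: cts_fun.
  have ca1 : continuous a1 by exact: cts_fun.
  have ca2 : continuous a2 by exact: cts_fun.
  have fE y i j : f y i j = b y i j - ((a1 y)%:C * p1 y i j + (a2 y)%:C * p2 y i
    j).
    by rewrite /f !mxE.
  apply: cts_mxC => i j.
    have -> : (fun x => Re (f x i j)) = (fun y => Re (b y i j) -
       (a1 y * Re (p1 y i j) + a2 y * Re (p2 y i j))).
      apply/funext => y; rewrite fE !raddfB !raddfD /=.
      by case: (p1 y i j) => ? ?; case: (p2 y i j) => ? ? /=; ring.
    apply: ctsD; first exact: (cts_Re (cts_centry (i := i) (j := j) cb)).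
    apply: ctsN; apply: ctsD; apply: ctsM => //.
      exact: (cts_Re (cts_centry (i := i) (j := j) cp1)).
    exact: (cts_Re (cts_centry (i := i) (j := j) cp2)).
  have -> : (fun x => Im (f x i j)) = (fun y => Im (b y i j) -
       (a1 y * Im (p1 y i j) + a2 y * Im (p2 y i j))).
    apply/funext => y; rewrite fE !raddfB !raddfD /=.
    by case: (p1 y i j) => ? ?; case: (p2 y i j) => ? ? /=; ring.
  apply: ctsD; first exact: (cts_Im (cts_centry (i := i) (j := j) cb)).
  apply: ctsN; apply: ctsD; apply: ctsM => //.
    exact: (cts_Im (cts_centry (i := i) (j := j) cp1)).
  exact: (cts_Im (cts_centry (i := i) (j := j) cp2)).
have fy y : op_norm (f y) < 1 by apply: le_lt_trans f1; exact: le_CM2_norm.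
pose a y := Re (p1 y 0 0); pose s y := Re (p1 y 0 1); pose t y := Im (p1 y 0 1).
have e1 y := rank_one_projectionE (h1 y) (i1 y) (r1 y).
have e2 y : forall w, p2 y *m vecC w = vecC (proj_act (1 - a y) (- s y) (- t y)
  w).
  have [k1 m1] := e1 y; have [k2 m2] := rank_one_projectionE (h2 y) (i2 y) (r2
    y).
  have [|<- <- <- //] := orthogonal_proj_act k1 k2.
  move=> w; apply: vecC_inj; rewrite -m1 -m2 mulmxA (o y).1 mul0mx.
  by apply/colP; apply: ord2_ind; rewrite !mxE.
have ca : continuous (a \o g).
  by apply: (cts_comp cg); apply: cts_Re; apply: cts_centry; exact: cts_fun.
have cs : continuous (s \o g).
  by apply: (cts_comp cg); apply: cts_Re; apply: cts_centry; exact: cts_fun.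
have ct : continuous (t \o g).
  by apply: (cts_comp cg); apply: cts_Im; apply: cts_centry; exact: cts_fun.
pose d x := a1 (g x) - a2 (g x).
have cd : continuous d.
  apply: ctsD; first by apply: (cts_comp cg); exact: cts_fun.
  by apply: ctsN; apply: (cts_comp cg); exact: cts_fun.
have gap u : sqnorm u = 1 ->
    0 < d u * (2 * hre u (proj_act (a (g u)) (s (g u)) (t (g u)) u) - 1).
  move=> u1; have := fy (g u); rewrite /f bu // => fu.
  exact: hopf_gap u1 (e1 (g u)).2 (e2 (g u)) fu.
have d0 u : sqnorm u = 1 -> d u != 0.
  by move=> /gap; apply: contraTneq => ->; rewrite mul0r ltxx.
pose e := vec4 1 0 0 0 : E.
have e11 : sqnorm e = 1 by rewrite sqnorm4 !vec4E; ring.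
have h0 u : hre u 0 = 0 by rewrite /hre !row0E; ring.
(* With q = <u, p1 u>, a positive [d] gives q > 1/2, so p1 u <> 0; a negative one gives q < 1/2, so
   the complement p2 has p2 u <> 0. *)
have [de|de|de] := ltgtP 0 (d e); last by have := d0 _ e11; rewrite -de eqxx.
  apply: (no_transverse_projection ca cs ct) => [x|u u1];
    first exact: (e1 (g x)).1.
  have du := sphere_same_sign cd d0 e11 u1 de.
  apply: contraTneq (gap _ u1) => /= ->; rewrite h0 mulr0 sub0r mulrN1 oppr_gt0.
  by rewrite -leNgt ltW.
have cd' : continuous (fun x => - d x) by exact: ctsN.
have d0' u : sqnorm u = 1 -> - d u != 0 by move=> u1; rewrite oppr_eq0 d0.
apply: (@no_transverse_projection R (fun x => 1 - a (g x)) (fun x => - s (g x))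
  (fun x => - t (g x))) => [|||x|u u1].
- by apply: ctsD; [exact: cst_continuous|exact: ctsN].
- exact: ctsN.
- exact: ctsN.
- by have := (e1 (g x)).1; rewrite -/(a _) -/(s _) -/(t _) => h;
    rewrite !sqrrN -h; ring.
have du : 0 < - d u by apply: sphere_same_sign cd' d0' e11 u1 _;
  rewrite oppr_gt0.
apply: contraTneq (gap _ u1) => q0.
have : hre u (proj_act (a (g u)) (s (g u)) (t (g u)) u) = 1.
  have := congr1 (hre u) q0; rewrite h0 /=.
  have -> : forall p q r : R, hre u (proj_act (1 - p) (- q) (- r) u) =
      sqnorm u - hre u (proj_act p q r u).
    by move=> p q r; rewrite sqnorm4 /hre !vec4E; ring.
  by rewrite u1; lra.
by move=> ->; rewrite -leNgt; lra.
Qed.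
End Hopf.

Lemma compact_finite_bigcup (T : topologicalType) (I : finType) (F : I ->
  set T) :
  (forall i, compact (F i)) -> compact (\bigcup_i F i).
Proof.
move=> cF; apply/compact_near_coveringP => J G P fG HP.
have : \forall j \near G, forall i, F i `<=` P j.
  apply: filter_forall => i; have /compact_near_coveringP := cF i; apply=> x Fx.
  by apply: HP; exists i.
by apply: filterS => j Pj x [i _ Fx]; exact: Pj Fx.
Qed.

(** A characteristic map is controlled on the closed disc only, so it is composed with maps into
    that disc. *)
Lemma cts_within_comp (T S U : topologicalType) (A : set S) (f : S ->
  U) (h : T -> S) :
  {within A, continuous f} -> continuous h -> (forall x, A (h x)) ->
  continuous (fun x => f (h x)).
Proof.
move=> cf ch Ah x B fB.
have : nbhs (h x) (fun z => A z -> B (f z)).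
  have : nbhs_subspace (h x : subspace A) (f @^-1` B) := cf (h x) B fB.
  by rewrite -(nbhs_subspace_in (Ah x)).
move=> nB; have : nbhs x (fun y => A (h y) -> B (f (h y))) := ch x _ nB.
move=> nh; suff : nbhs x (fun y => B (f (h y))) by [].
by apply: filterS nh => y; apply; exact: Ah.
Qed.

(** * The spectrum of a traceless element *)

Section Spectrum.
Variable R : realType.
Notation E := 'rV[R]_4.

Lemma hopf_sqr (w : E) : hopf w *m hopf w = ((sqnorm w ^+ 2)%:C)%:M.
Proof.
apply/matrixP; apply: ord2_ind; apply: ord2_ind;
  rewrite mulmx2E !mxE /= sqnorm4;
  apply/eqP; rewrite eq_complex /=; apply/andP; split; apply/eqP; ring.
Qed.

Lemma hopf_hermitian (c : R) (w : E) : c%:C *: hopf w \is hermsymmx.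
Proof.
apply/is_hermitianmxP; rewrite expr0 scale1r.
apply/matrixP; apply: ord2_ind; apply: ord2_ind; rewrite !mxE /=;
  apply/eqP; rewrite eq_complex /=; apply/andP; split; apply/eqP; ring.
Qed.

Lemma hopfZ (c : R) (w : E) : hopf (c *: w) = (c ^+ 2)%:C *: hopf w.
Proof.
apply/matrixP; apply: ord2_ind; apply: ord2_ind; rewrite !mxE /=;
  apply/eqP; rewrite eq_complex /=; apply/andP; split; apply/eqP; ring.
Qed.

Lemma ctsCM (T : topologicalType) (f g : T -> R[i]) :
  continuous f -> continuous g -> continuous (fun x => f x * g x).
Proof. by move=> cf cg x; exact: (@continuousM R[i] T f g x (cf x) (cg x)). Qed.

Lemma ctsCD (T : topologicalType) (f g : T -> R[i]) :
  continuous f -> continuous g -> continuous (fun x => f x + g x).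
Proof. by move=> cf cg x; exact: (@continuousD R[i] R[i] T f g x (cf x) (cg x)).
Qed.

Lemma ctsCV (T : topologicalType) (f : T -> R[i]) : (forall x, f x != 0) ->
  continuous f -> continuous (fun x => (f x)^-1).
Proof. by move=> f0 cf x; exact: (@continuousV R[i] T f x (f0 x) (cf x)). Qed.

(** By Cayley-Hamilton b^2 is scalar when the trace is 0, so (b - l)(b + l) is the scalar b^2 - l^2.
    Where it never vanishes, it gives an explicit continuous inverse. *)
Lemma spectrum_traceless (Y : topologicalType) (b : CM2 R Y) :
  (forall y, b y 1 1 = - b y 0 0) ->
  (forall y, exists2 r, 0 <= r <= 1 & b y *m b y = ((r ^+ 2)%:C)%:M) ->
  (forall t, 0 <= t <= 1 -> exists y, b y *m b y = ((t ^+ 2)%:C)%:M) ->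
  spectrum b = [set t%:C | t in `[-1, 1]%classic].
Proof.
move=> b0 br bt.
have adj y l : (b y - l%:M) *m (b y + l%:M) = ((b y *m b y) 0 0 - l ^+ 2)%:M /\
    (b y + l%:M) *m (b y - l%:M) = ((b y *m b y) 0 0 - l ^+ 2)%:M.
  by split; apply/matrixP; apply: ord2_ind; apply: ord2_ind;
    rewrite !mulmx2E !mxE ?b0 /= ?mulr1n ?mulr0n; ring.
apply/seteqP; split=> [l /= nl|_ [t /= t1 <-]].
  apply: contrapT => l1; apply: nl.
  have cb : continuous b by exact: cts_fun.
  pose N y := (b y *m b y) 0 0 - l ^+ 2.
  have N0 y : N y != 0.
    rewrite /N; have [r r01 ->] := br y; rewrite !mxE /= mulr1n rmorphXn
      subr_sqr.
    apply: contra_notN l1; rewrite mulf_eq0 subr_eq0 addr_eq0 =>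
      /orP[/eqP <-|/eqP rl].
      by exists r => //; rewrite in_itv /=; lra.
    by exists (- r); [rewrite in_itv /=; lra|rewrite rmorphN /= rl opprK].
  have cN : continuous N.
    rewrite /N; under eq_fun do rewrite mulmx2E.
    apply: ctsCD (@cst_continuous _ _ _).
    by apply: ctsCD; apply: ctsCM; exact: cts_centry.
  have cc : continuous (fun y => (N y)^-1 *: (b y + l%:M)).
    apply: continuous_mx => i j; under eq_fun do rewrite !mxE.
    apply: ctsCM; first exact: ctsCV.
    by apply: ctsCD (@cst_continuous _ _ _); exact: cts_centry.
  exists (mkcts cc) => y; rewrite /= /mkcts; have [e1 e2] := adj y l; split.
    by rewrite -scalemxAr e1 scale_scalar_mx mulVf.
  by rewrite -scalemxAl e2 scale_scalar_mx mulVf.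
move=> [c cE].
have [y yt] : exists y, b y *m b y = ((t ^+ 2)%:C)%:M.
  have [t0|t0] := leP 0 t; first by apply: bt; rewrite t0; move: t1;
    rewrite in_itv /= => /andP[].
  have [|y] := bt (- t); last by rewrite sqrrN; exists y.
  by move: t1; rewrite in_itv /=; lra.
have [e1 e2] := adj y t%:C; have [c1 c2] := cE y.
(* Invertibility of b - t and (b - t)(b + t) = 0 force b = - t. Trace 0 then gives t = 0, and b - t
   = 0 is not invertible. *)
have bt0 : b y + (t%:C)%:M = 0.
  rewrite -[LHS]mul1mx -c2 -mulmxA e1 yt mxE /= mulr1n rmorphXn subrr.
  by rewrite mul_mx_scalar scale0r.
have b00 : b y 0 0 = - t%:C.
  by have := congr1 (fun M : 'M[R[i]]_2 => M 0 0) bt0;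
    rewrite !mxE /= mulr1n => /eqP; rewrite addr_eq0 => /eqP.
have b11 : b y 1 1 = - t%:C.
  by have := congr1 (fun M : 'M[R[i]]_2 => M 1 1) bt0;
    rewrite !mxE /= mulr1n => /eqP; rewrite addr_eq0 => /eqP.
have t00 : t%:C = 0 :> R[i].
  have := b0 y; rewrite b00 b11 opprK => /eqP; rewrite eq_sym -addr_eq0 -mulr2n.
  by rewrite mulrn_eq0 /= => /eqP.
have : (1%:M : 'M[R[i]]_2) = 0.
  by rewrite -c1 t00; move: bt0; rewrite t00 raddf0 addr0 subr0 => ->;
    rewrite mul0mx.
by move/matrixP => /(_ 0 0) /eqP; rewrite !mxE oner_eq0.
Qed.
End Spectrum.

(** * Extension from a cell *)

Section Cell.
Variable R : realType.
Notation E := 'rV[R]_4.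

Lemma sqnorm_row_mx m n (x : 'rV[R]_m) (y : 'rV[R]_n) :
  sqnorm (row_mx x y) = sqnorm x + sqnorm y.
Proof.
rewrite /sqnorm big_split_ord; congr (_ + _).
  by apply: eq_bigr => i _; rewrite row_mxEl.
by apply: eq_bigr => i _; rewrite row_mxEr.
Qed.

Lemma sqnorm0 n : sqnorm (0 : 'rV[R]_n) = 0.
Proof. by apply/eqP; rewrite sqnorm_eq0. Qed.

Lemma cts_row_mx0 (T : topologicalType) m n (f : T -> 'rV[R]_m) :
  continuous f -> continuous (fun x => row_mx (f x) (0 : 'rV[R]_n)).
Proof.
move=> cf; apply: continuous_mx => i j; under eq_fun do rewrite mxE.
case: (fintype.split j) => k; first exact: cts_coord.
exact: cst_continuous.
Qed.

Lemma cts_lsubmx (T : topologicalType) m n (f : T -> 'rV[R]_(m + n)) :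
  continuous f -> continuous (fun x => lsubmx (f x)).
Proof.
move=> cf; apply: continuous_mx => i j; under eq_fun do rewrite mxE.
exact: cts_coord.
Qed.

Lemma cts_hopf (T : topologicalType) (k : T -> R) (f : T -> E) :
  continuous k -> continuous f -> continuous (fun x => (k x)%:C *: hopf (f x)).
Proof.
move=> ck cf; apply: continuous_mx => i j; under eq_fun do rewrite mxE.
apply: ctsCM; first exact: cts_complex ck (@cst_continuous _ _ _).
by move: i j; do 2 apply: ord2_ind; under eq_fun do rewrite hopfE;
  apply: cts_complex; cts.
Qed.

(** On the slice, with s = |w|^2, the eigenvalues are plus and minus (8 - 16 s) s = 1 - (4 s - 1)^2
    while s <= 1/2. They reach 1 and -1 at |w| = 1/2, and the support stays away from the boundary
    of the cell. *)
Definition bump_hopf m (x : 'rV[R]_(4 + m)) : 'M[R[i]]_2 :=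
  (Num.max 0 (8 - 16 * sqnorm x))%:C *: hopf (lsubmx x).

Lemma bump_hopf_continuous m : continuous (@bump_hopf m).
Proof.
apply: cts_hopf; last by apply: cts_lsubmx; exact: cts_id.
by cts.
Qed.

(** On the open cell, continuity comes from [chi] being a homeomorphism onto it. Off the cell, the
    image [K] of the disc |x|^2 <= 1/2 is compact, hence closed in a Hausdorff space, and the
    extension is 0 on its complement. *)
Lemma extend_from_cell (Y : topologicalType) n (chi : 'rV[R]_n -> Y)
    (be : 'rV[R]_n -> 'M[R[i]]_2) :
  hausdorff_space Y ->
  {within @closed_disc R n, continuous chi} ->
  set_inj (@open_disc R n) chi ->
  (forall U, open U -> exists2 V : set Y, open V &
     chi @` (U `&` @open_disc R n) = V `&` (chi @` @open_disc R n)) ->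
  open (chi @` @open_disc R n) ->
  continuous be -> (forall x, 1 / 2 <= sqnorm x -> be x = 0) ->
  exists b : Y -> 'M[R[i]]_2, [/\ continuous b,
    forall x, sqnorm x < 1 -> b (chi x) = be x &
    forall y, b y = 0 \/ exists2 x, sqnorm x < 1 & y = chi x].
Proof.
move=> haus cchi ichi ochi ocell cbe be0.
pose cell := chi @` @open_disc R n.
pose inv y := get [set x | open_disc x /\ chi x = y].
pose b y := if pselect (cell y) then be (inv y) else 0.
have bchi x : sqnorm x < 1 -> b (chi x) = be x.
  move=> x1; rewrite /b; case: pselect => [cx|ncx]; last by exfalso; apply: ncx;
    exists x.
  congr be; have [|d e] := @getPex _ [set z | open_disc z /\ chi z = chi x];
    first by exists x.
  by apply: ichi; rewrite ?inE.
have b0 y : ~ cell y -> b y = 0 by rewrite /b; case: pselect.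
exists b; split=> //; last first.
  move=> y; have [[x x1 <-]|/b0] := pselect (cell y); last by left.
  by right; exists x.
pose K := chi @` [set x | sqnorm x <= 1 / 2].
have Kclosed : closed K.
  apply: compact_closed => //; apply: continuous_compact;
    last exact: compact_disc.
  apply: continuous_subspaceW cchi => x /=; rewrite /closed_disc /=; lra.
move=> y A.
have [[x x1 <-]|ncy] := pselect (cell y).
  rewrite bchi // => /(cbe x); rewrite /= nbhsE => -[U [oU Ux] UA].
  have [V oV VE] := ochi _ oU.
  have : nbhs (chi x) (V `&` cell).
    apply: open_nbhs_nbhs; split; first exact: openI.
    by rewrite -VE; exists x.
  move=> nV; suff : nbhs (chi x) (b @^-1` A) by [].
  apply: filterS nV; rewrite -VE => _ [z [Uz z1] <-] /=; rewrite bchi //.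
  exact: UA.
move=> bA; have Ab0 : A 0 by rewrite -(b0 _ ncy); exact: nbhs_singleton.
have nK : nbhs y (~` K).
  apply: open_nbhs_nbhs; split; first exact: closed_openC.
  move=> [x /= x12 xy]; apply: ncy; exists x => //; rewrite /open_disc /=; lra.
suff : nbhs y (b @^-1` A) by [].
apply: filterS nK => z nKz /=.
suff -> : b z = 0 by [].
have [[x x1 xz]|/b0//] := pselect (cell z).
rewrite -xz bchi //; apply: be0; rewrite leNgt; apply/negP => x12.
by apply: nKz; exists x => //=; exact: ltW.
Qed.

Lemma bump_hopf_sqr m (x : 'rV[R]_(4 + m)) : exists2 r, 0 <= r <= 1 &
  bump_hopf x *m bump_hopf x = ((r ^+ 2)%:C)%:M.
Proof.
pose k := Num.max 0 (8 - 16 * sqnorm x).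
have k0 : 0 <= k by rewrite le_max lexx.
have s0 := sqnorm_ge0 (lsubmx x).
exists (k * sqnorm (lsubmx x)).
  rewrite mulr_ge0 //=; have : sqnorm (lsubmx x) <= sqnorm x.
    by rewrite -[in leRHS](hsubmxK x) sqnorm_row_mx lerDl sqnorm_ge0.
  move=> sx; have [k1|/ltW k1] := leP (8 - 16 * sqnorm x) 0.
    by rewrite /k max_l // mul0r ler01.
  rewrite /k max_r //; have := sqr_ge0 (4 * sqnorm (lsubmx x) - 1).
  nra.
rewrite /bump_hopf -/k -scalemxAl -scalemxAr hopf_sqr scalerA scale_scalar_mx.
by congr (_%:M); rewrite -!rmorphM; congr (_%:C); ring.
Qed.

Theorem cell_hopf_element (Y : topologicalType) m (chi : 'rV[R]_(4 + m) -> Y) :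
  hausdorff_space Y -> compact [set: Y] ->
  {within @closed_disc R (4 + m), continuous chi} ->
  set_inj (@open_disc R (4 + m)) chi ->
  (forall U, open U -> exists2 V : set Y, open V &
     chi @` (U `&` @open_disc R (4 + m)) = V `&` (chi @` @open_disc R (4 + m)))
       ->
  open (chi @` @open_disc R (4 + m)) ->
  exists b : CM2 R Y,
    [/\ self_adjoint b,
        spectrum b = [set t%:C | t in `[-1, 1]%classic] &
        ~ approx_diagonalizable b].
Proof.
move=> haus cY cchi ichi ochi ocell.
have [|b [cb bE b0]] := extend_from_cell haus cchi ichi ochi ocell
  (@bump_hopf_continuous m).
  by move=> x x12; rewrite /bump_hopf max_l ?scale0r //; lra.
pose emb (w : E) : 'rV[R]_(4 + m) := row_mx w 0.
have emb1 w : sqnorm (emb w) = sqnorm w by rewrite sqnorm_row_mx sqnorm0 addr0.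
have bemb w : sqnorm w < 1 -> b (chi (emb w)) = (Num.max 0 (8 - 16 * sqnorm
  w))%:C *: hopf w.
  by move=> w1; rewrite bE ?emb1 // /bump_hopf emb1 row_mxKl.
exists (mkcts cb); split.
- move=> y; rewrite /= /mkcts; have [->|[x x1 ->]] := b0 y; last first.
    by rewrite bE // hopf_hermitian.
  by rewrite -(scale0r (hopf 0)) -[0]/(0%:C) hopf_hermitian.
- apply: spectrum_traceless => [y|y|t /andP[t0 t1]]; rewrite /= /mkcts.
  + have [->|[x x1 ->]] := b0 y; first by rewrite !mxE oppr0.
    rewrite bE // /bump_hopf !mxE /=.
    by apply/eqP; rewrite eq_complex /=; apply/andP; split; apply/eqP; ring.
  + have [->|[x x1 ->]] := b0 y; last by rewrite bE //; exact: bump_hopf_sqr.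
    by exists 0; rewrite ?lexx ?ler01 // mul0mx expr0n /= raddf0.
  (* Solves 1 - (4 x - 1)^2 = t for x = |w|^2, with the smaller root. *)
  + pose s := Num.sqrt (1 - t); have s0 : 0 <= s by exact: sqrtr_ge0.
    have s2 : s ^+ 2 = 1 - t by rewrite sqr_sqrtr // subr_ge0.
    have s1 : s <= 1 by nra.
    pose w := vec4 (Num.sqrt ((1 - s) / 4)) 0 0 0.
    have w2 : sqnorm w = (1 - s) / 4.
      by rewrite sqnorm4 !vec4E sqr_sqrtr; [ring|rewrite divr_ge0 // subr_ge0].
    exists (chi (emb w)); rewrite bemb w2; last lra.
    rewrite max_r; last lra.
    rewrite -scalemxAl -scalemxAr hopf_sqr scalerA scale_scalar_mx w2.
    congr (_%:M); rewrite -!rmorphM; congr (_%:C).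
    have -> : t = 1 - s ^+ 2 by rewrite s2; ring.
    by field.
(* The unit sphere is shrunk to radius 1/2, where the bump 4 compensates the factor 1/4 by which
   [hopf] scales. *)
- pose g (x : E) := chi (emb (2^-1 *: retract x)).
  have gdisc x : sqnorm (emb (2^-1 *: retract x)) < 1.
    by rewrite emb1 sqnormZ; have := retract_disc x; lra.
  apply: (@hopf_not_diagonalizable _ _ g) => //.
    apply: (cts_within_comp cchi); last by move=> x; exact: ltW (gdisc x).
    apply: cts_row_mx0; apply: ctsZ; [exact: cst_continuous|exact: retract_continuous].
  move=> u u1; rewrite /= /mkcts /g retract_id ?u1 // bemb;
    last by rewrite sqnormZ u1; lra.
  rewrite sqnormZ u1 hopfZ scalerA max_r; last lra.
  rewrite -rmorphM -[RHS]scale1r; congr (_ *: _); rewrite -[RHS]/(1%:C);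
    congr (_%:C).
  by field.
Qed.
End Cell.

(** * Top cells of a finite CW complex *)

Theorem lemma7p8 (R : realType) (Y : topologicalType) (X : finite_CW R Y)
    (dimY : (3 < CW_dim X)%N) :
  exists b : CM2 R Y,
    [/\ self_adjoint b,
        spectrum b = [set t%:C | t in `[-1, 1]%classic] &
        ~ approx_diagonalizable b].
Proof.
have haus := CW_hausdorff X.
have cellC (e : cell X) : compact (@char_map _ _ X e @`
    @closed_disc R (cell_dim e)).
  by apply: continuous_compact; [exact: char_map_continuous|exact: compact_disc].
have openclosed (e : cell X) : open_cell e `<=` @char_map _ _ X e @`
  @closed_disc R (cell_dim e).
  by move=> _ [x x1 <-]; exists x => //; exact: ltW.
have cover y : exists e : cell X, open_cell e y.
  have : (\bigcup_e open_cell (e : cell X)) y by rewrite open_cells_cover.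
  by move=> [e _ ey]; exists e.
have cY : compact [set: Y].
  rewrite (_ : [set: Y] = \bigcup_(e : cell X) (@char_map _ _ X e @`
    @closed_disc R (cell_dim e))).
    exact: compact_finite_bigcup.
  apply/seteqP; split=> // y _; have [e ey] := cover y.
  by exists e => //; exact: openclosed.
have [|e He] := @bigop.eq_bigmax (cell X) (@cell_dim _ _ X).
  rewrite lt0n; apply: contraTneq dimY => /card0_eq X0.
  by rewrite /CW_dim big_pred0 // => i; have := X0 i; rewrite !inE.
have dim_e (e' : cell X) : (cell_dim e' <= cell_dim e)%N by rewrite -He;
  exact: bigop.leq_bigmax.
have disj (e1 e2 : cell X) y : open_cell e1 y -> open_cell e2 y -> e1 = e2.
  by move=> y1 y2; apply: (open_cells_disjoint (f := X)) => //; exists y.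
(* A top cell misses the closed image of every other cell: the open part by disjointness, the
   boundary because it lies in cells of smaller dimension. These finitely many compact images make
   up its complement. *)
have oe : open (open_cell e).
  rewrite -[open_cell e]setCK; apply: closed_openC.
  rewrite (_ : ~` _ = \bigcup_(e' : cell X)
    (if e' == e then set0 else @char_map _ _ X e' @`
      @closed_disc R (cell_dim e'))).
    apply: compact_closed => //; apply: compact_finite_bigcup => e'.
    by case: ifP => // _; exact: compact0.
  apply/seteqP; split=> [y ney|y [e' _]].
    have [e' e'y] := cover y; exists e' => //; case: eqP => [e'e|_];
      last exact: openclosed.
    by case: ney; rewrite -e'e.
  case: eqP => // ne [x x1 <-] ey; move: x1; rewrite /closed_disc /= le_eqVlt =>
    /orP[/eqP x1|x1].
    have xS : (@char_map _ _ X e' @` @unit_sphere R (cell_dim e'))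
        (@char_map _ _ X e' x).
      by exists x.
    have [e'' /= de'' e''y] := char_map_boundary xS.
    by move: de''; rewrite -(disj _ _ _ ey e''y) ltnNge dim_e.
  by apply: ne; apply: (disj e' e _ _ ey); exists x.
have := @char_map_open _ _ X e; have := @char_map_inj _ _ X e.
have := @char_map_continuous _ _ X e; move: oe; rewrite /open_cell.
have : (3 < cell_dim e)%N by rewrite -He.
(* The type of the characteristic map depends on the dimension, so both are generalized before n is
   replaced by 4 + m. *)
move: (@char_map _ _ X e); move: (cell_dim e) => n chi n3.
have [m nE] : exists m, n = (4 + m)%N by exists (n - 4)%N; rewrite subnKC.
by subst n => oe c1 c2 c3; exact: cell_hopf_element c3 oe.
Qed.
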